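(* Let $G$ be a profinite group. Let $O^{\mathrm{[FD]}}(G)$ be the intersection of all normal subgroups $K$ of $G$ such that $G/K$ is Fitting-degenerate, and let $O_{\mathrm{[FR]}}(G)$ be the subgroup generated by all normal Fitting-regular subgroups of $G$. Then $O^{\mathrm{[FD]}}(G) = O_{\mathrm{[FR]}}(G)$, and this common subgroup $R$ is a characteristic subgroup of $G$ such that: (i) a subnormal subgroup of $G$ is Fitting-regular if and only if it is contained in $R$; (ii) $G/R$ is Fitting-degenerate, and it covers every Fitting-degenerate quotient of $G$ (that is, if $K$ is a normal subgroup of $G$ with $G/K$ Fitting-degenerate, then $R \leq K$). Moreover, $O_{\mathrm{[FR]}}(H) = O_{\mathrm{[FR]}}(G) \cap H$ for every open subgroup $H$ of $G$.
   Context: Profinite groups are regarded as topological groups: subgroups are required to be closed, homomorphisms continuous, and generation means topological generation. For a profinite group $G$ and a prime $p$, $O_p(G)$ is the subgroup generated by all normal pro-$p$ subgroups of $G$; the Fitting subgroup $F(G)$ is the subgroup generated by the $O_p(G)$ for all primes $p$. A profinite group $Q$ is quasisimple if $Q$ is perfect and $Q/Z(Q)$ is simple. A component of $G$ is a subnormal quasisimple subgroup of $G$; the layer $E(G)$ is the subgroup generated by all components of $G$. The generalised Fitting subgroup $F^*(G)$ is the subgroup generated by $F(G)$ and $E(G)$. $G$ is Fitting-degenerate if $F^*(G)$ is trivial. $G$ is Fitting-regular if no non-trivial image (quotient by a closed normal subgroup) of $G$ is Fitting-degenerate. *)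

(* Defs.v *)
From HB Require Import structures.
From mathcomp Require Import all_boot all_classical topology.

Set Implicit Arguments.
Unset Strict Implicit.
Unset Printing Implicit Defensive.

Local Open Scope classical_set_scope.
Local Open Scope quotient_scope.
Local Open Scope group_scope.

HB.mixin Record isTopGroup G of Topological G & Group G := {
  mulg_continuous : continuous (fun xy : G * G => xy.1 * xy.2);
  invg_continuous : continuous (fun x : G => x^-1);
  topgroup_hausdorff : hausdorff_space G
}.

(* Topological groups are Hausdorff by convention, so [profinite] below only adds
   compactness and total disconnectedness. *)
#[short(type="topGroupType")]
HB.structure Definition TopGroup :=
  {G of isTopGroup G & Topological G & Group G}.

Definition profinite (G : topGroupType) : Prop :=
  compact [set: G] /\ totally_disconnected [set: G].

Section TopGroupTheory.
Variable G : topGroupType.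

Lemma continuousM (T : topologicalType) (f g : T -> G) :
  continuous f -> continuous g -> continuous (fun z => f z * g z).
Proof.
move=> cf cg z; apply: (@continuous2_cvg _ _ _ _ _ _ f g mul) => //=.
- exact: (@mulg_continuous G (f z, g z)).
- exact: cf.
- exact: cg.
Qed.

Lemma continuousV (T : topologicalType) (f : T -> G) :
  continuous f -> continuous (fun z => (f z)^-1).
Proof.
move=> cf z; apply: cvg_comp; first exact: cf.
exact: invg_continuous.
Qed.

Lemma topgroup_closed1 : closed [set (1 : G)].
Proof.
apply: accessible_closed_set1; apply: hausdorff_accessible.
exact: topgroup_hausdorff.
Qed.

End TopGroupTheory.

(* Subgroups of profinite groups are closed by convention; closedness is part of
   the record here, and hence of every notion below (generation, subnormal
   chains, simplicity, quotients). *)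
Record csubgroup (G : topGroupType) := CSubgroup {
  csub_set :> set G;
  csub_closed : closed csub_set;
  csub1 : csub_set 1;
  csubM : forall x y, csub_set x -> csub_set y -> csub_set (x * y);
  csubV : forall x, csub_set x -> csub_set x^-1
}.

Record nsubgroup (G : topGroupType) := NSubgroup {
  nsub_csub :> csubgroup G;
  nsub_normal : forall x k,
    csub_set nsub_csub k -> csub_set nsub_csub (k ^ x)
}.

Section Subgroups.
Variable G : topGroupType.

Program Definition csub_bigcap (P : set (csubgroup G)) : csubgroup G :=
  @CSubgroup G (\bigcap_(H in P) (H : set G)) _ _ _ _.
Next Obligation. by move=> P; apply: closed_bigI => H _; exact: csub_closed. Qed.
Next Obligation. by move=> P H _; exact: csub1. Qed.
Next Obligation. by move=> P x y Px Py H PH; apply: csubM; [exact: Px|exact: Py]. Qed.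
Next Obligation. by move=> P x Px H PH; apply: csubV; exact: Px. Qed.

Program Definition nsub_bigcap (P : set (nsubgroup G)) : nsubgroup G :=
  @NSubgroup G (csub_bigcap [set nsub_csub K | K in P]) _.
Next Obligation.
by move=> P x k Pk _ [K PK <-]; apply: nsub_normal; apply: Pk; exists K.
Qed.

Definition gen (A : set G) : csubgroup G :=
  csub_bigcap [set H : csubgroup G | A `<=` H].

Lemma center_closed : closed [set z : G | forall x : G, commute z x].
Proof.
have -> : [set z : G | forall x : G, commute z x] =
    \bigcap_(x in [set: G]) (fun z : G => (z * x) * (x * z)^-1) @^-1` [set 1].
  apply/seteqP; split => [z Zz x _ /=|z Zz x]; first by rewrite Zz mulgV.
  have /= e := Zz x I; rewrite /commute.
  by rewrite -[LHS](mulgVK (x * z)) e mul1g.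
apply: closed_bigI => x _.
apply: preimage_closed; last exact: topgroup_closed1.
move=> + _; change (continuous (fun z : G => (z * x) * (x * z)^-1)).
have ci : continuous (fun z : G => z) by move=> z.
have cc : continuous (fun _ : G => x) by exact: cst_continuous.
by apply: continuousM; [|apply: continuousV]; apply: continuousM.
Qed.

Program Definition center : nsubgroup G :=
  @NSubgroup G
    (@CSubgroup G [set z : G | forall x : G, commute z x] center_closed _ _ _) _.
Next Obligation. by move=> x; rewrite /commute mul1g mulg1. Qed.
Next Obligation.
by move=> x y cx cy z; apply/commute_sym/commuteM; apply/commute_sym.
Qed.
Next Obligation. by move=> x cx z; apply/commute_sym/commuteV/commute_sym/cx. Qed.
Next Obligation. by move=> x z cz; rewrite /conjg cz mulKg. Qed.

End Subgroups.

Definition subgrp (G : topGroupType) (H : csubgroup G) : Type := set_type H.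

Section SubgroupAsGroup.
Variables (G : topGroupType) (H : csubgroup G).

HB.instance Definition _ := SubChoice.on (subgrp H).
HB.instance Definition _ :=
  Topological.copy (subgrp H) (set_type H).

Lemma subgrp_closed : group_closed (fun x : G => x \in (H : set G)).
Proof.
split=> [|x y xH yH]; rewrite unfold_in; first exact/mem_set/csub1.
apply/mem_set/csubM; first exact: set_mem.
exact/csubV/set_mem.
Qed.
HB.instance Definition _ := SubChoice_isSubGroup.Build G
  (fun x : G => x \in (H : set G)) (subgrp H) subgrp_closed.

Lemma subgrp_val_continuous : continuous (val : subgrp H -> G).
Proof. exact: initial_continuous. Qed.

Lemma subgrp_continuous (T : topologicalType) (f : T -> subgrp H) :
  continuous (fun t => val (f t)) -> continuous f.
Proof.
move=> /continuousP cf; apply/continuousP => _ [A oA <-].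
exact: (cf _ oA).
Qed.

Lemma subgrp_mulg_continuous :
  continuous (fun xy : subgrp H * subgrp H => xy.1 * xy.2).
Proof.
apply: subgrp_continuous.
have -> : (fun t : subgrp H * subgrp H => val (t.1 * t.2)) =
          (fun t => val t.1 * val t.2) by apply/funext => t; rewrite gmulfM.
apply: continuousM => t.
- by apply: cvg_comp; [exact: cvg_fst|exact: subgrp_val_continuous].
- by apply: cvg_comp; [exact: cvg_snd|exact: subgrp_val_continuous].
Qed.

Lemma subgrp_invg_continuous : continuous (fun x : subgrp H => x^-1).
Proof.
apply: subgrp_continuous.
have -> : (fun t : subgrp H => val t^-1) = (fun t => (val t)^-1).
  by apply/funext => t; rewrite gmulfV.
exact/continuousV/subgrp_val_continuous.
Qed.

Lemma subgrp_hausdorff : hausdorff_space (subgrp H).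
Proof.
move=> p q pq; apply: val_inj; apply: (@topgroup_hausdorff G) => A B nA nB.
have [z [zA zB]] := pq _ _ (subgrp_val_continuous nA)
                           (subgrp_val_continuous nB).
by exists (val z).
Qed.

HB.instance Definition _ := isTopGroup.Build (subgrp H)
  subgrp_mulg_continuous subgrp_invg_continuous subgrp_hausdorff.

End SubgroupAsGroup.

Section Quotient.
Variables (G : topGroupType) (K : nsubgroup G).

Definition coset_rel (x y : G) : bool := (x^-1 * y) \in (K : set G).

Lemma coset_rel_refl : reflexive coset_rel.
Proof. by move=> x; rewrite /coset_rel mulVg; exact/mem_set/csub1. Qed.

Lemma coset_rel_sym : symmetric coset_rel.
Proof.
suff h x y : coset_rel x y -> coset_rel y x by move=> x y; apply/idP/idP; exact: h.
move=> /set_mem h; apply/mem_set.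
by rewrite -[X in _ * X]invgK -invgM; exact: csubV.
Qed.

Lemma coset_rel_trans : transitive coset_rel.
Proof.
move=> y x z /set_mem xy /set_mem yz; apply/mem_set.
by have := csubM xy yz; rewrite -mulgA mulVKg.
Qed.

Canonical coset_equiv := EquivRel coset_rel
  coset_rel_refl coset_rel_sym coset_rel_trans.

(* G / K with the quotient topology. *)
Definition quogrp : Type := quotient_topology {eq_quot coset_equiv}.

HB.instance Definition _ := Quotient.on quogrp.
HB.instance Definition _ := Topological.on quogrp.

Local Notation p := (\pi_quogrp : G -> quogrp).

Lemma quogrpP (x y : G) : p x = p y <-> csub_set K (x^-1 * y).
Proof.
split=> [/eqmodP h|h]; first exact: set_mem.
by apply/eqmodP; exact: mem_set.
Qed.

Definition quo_one : quogrp := p 1.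
Definition quo_mul (a b : quogrp) : quogrp := p (repr a * repr b).
Definition quo_inv (a : quogrp) : quogrp := p (repr a)^-1.

Lemma quo_mulE x y : quo_mul (p x) (p y) = p (x * y).
Proof.
have /quogrpP hx : p (repr (p x)) = p x by rewrite reprK.
have /quogrpP hy : p (repr (p y)) = p y by rewrite reprK.
apply/quogrpP.
have := csubM hy (nsub_normal y hx).
by rewrite /conjg invgM !mulgA mulgK.
Qed.

Lemma quo_invE x : quo_inv (p x) = p x^-1.
Proof.
have /quogrpP hx : p (repr (p x)) = p x by rewrite reprK.
apply/quogrpP.
have := nsub_normal x^-1 (csubV hx).
by rewrite /conjg invgM !invgK !mulgA mulgV mul1g.
Qed.

Lemma quo_mulA : associative quo_mul.
Proof.
elim/quotW=> x; elim/quotW=> y; elim/quotW=> z.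
by rewrite (quo_mulE y z) (quo_mulE x y) !quo_mulE mulgA.
Qed.
Lemma quo_mul1 : left_id quo_one quo_mul.
Proof. by elim/quotW=> x; rewrite quo_mulE mul1g. Qed.
Lemma quo_mulr1 : right_id quo_one quo_mul.
Proof. by elim/quotW=> x; rewrite quo_mulE mulg1. Qed.
Lemma quo_mulV : left_inverse quo_one quo_inv quo_mul.
Proof. by elim/quotW=> x; rewrite quo_invE quo_mulE mulVg. Qed.
Lemma quo_mulrV : right_inverse quo_one quo_inv quo_mul.
Proof. by elim/quotW=> x; rewrite quo_invE quo_mulE mulgV. Qed.

HB.instance Definition _ := isGroup.Build quogrp
  quo_mulA quo_mul1 quo_mulr1 quo_mulV quo_mulrV.

Lemma quogrp_piM x y : p (x * y) = p x * p y.
Proof. by rewrite -quo_mulE. Qed.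

Lemma quogrp_piV x : p x^-1 = (p x)^-1.
Proof. by rewrite -quo_invE. Qed.

Lemma quogrp_pi_continuous : continuous p.
Proof. exact: pi_continuous. Qed.

Lemma quogrp_pi_open (V : set G) : open V -> open (p @` V).
Proof.
move=> oV; rewrite /open /= /quotient_open.
have -> : p @^-1` (p @` V) =
    \bigcup_(k in (K : set G)) (fun x : G => x * k) @^-1` V.
  apply/seteqP; split => [x [v Vv /esym/quogrpP h]|x [k Kk Vxk]].
    by exists (x^-1 * v) => //=; rewrite mulVKg.
  by exists (x * k) => //; apply/esym/quogrpP; rewrite mulKg.
apply: bigcup_open => k _; apply: open_comp oV => + _.
change (continuous (fun x : G => x * k)); apply: continuousM; first by move=> z.
exact: cst_continuous.
Qed.

Lemma quogrp_pi_nbhs (x : G) (V : set G) : nbhs x V -> nbhs (p x) (p @` V).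
Proof.
rewrite nbhsE => -[U [oU Ux] sUV]; rewrite nbhsE; exists (p @` U).
  by split; [exact: quogrp_pi_open|exists x].
exact: image_subset.
Qed.

Lemma quogrp_mulg_continuous :
  continuous (fun xy : quogrp * quogrp => xy.1 * xy.2).
Proof.
move=> [a b] /= U; rewrite -[a]reprK -[b]reprK -quogrp_piM => nU.
have := @mulg_continuous G (repr a, repr b) _ (quogrp_pi_continuous nU).
move=> [[V W] /= [nV nW] sVW].
exists (p @` V, p @` W) => /=; last first.
  move=> [_ _] /= [[v Vv <-] [w Ww <-]].
  by have := sVW (v, w) (conj Vv Ww); rewrite /= quogrp_piM.
by split; apply: quogrp_pi_nbhs.
Qed.

Lemma quogrp_invg_continuous : continuous (fun x : quogrp => x^-1).
Proof.
apply/quotient_continuous.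
have -> : (fun x : quogrp => x^-1) \o p = p \o (fun x : G => x^-1).
  by apply/funext => x /=; rewrite quogrp_piV.
move=> x; apply: continuous_comp; first exact: invg_continuous.
exact: quogrp_pi_continuous.
Qed.

Lemma quogrp_hausdorff : hausdorff_space quogrp.
Proof.
move=> a b ab; apply: contrapT => neq.
pose O := (fun xy : G * G => xy.1^-1 * xy.2) @^-1` (~` (K : set G)).
have oO : open O.
  apply: open_comp; last exact/closed_openC/csub_closed.
  move=> + _; change (continuous (fun xy : G * G => xy.1^-1 * xy.2)).
  apply: continuousM; last by move=> z; exact: cvg_snd.
  by apply: continuousV => z; exact: cvg_fst.
have Oab : O (repr a, repr b).
  by move=> /= /quogrpP; rewrite !reprK.
have [[V W] /= [nV nW] sVW] := open_nbhs_nbhs (conj oO Oab).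
have /= [] := ab (p @` V) (p @` W).
- by rewrite -[a]reprK; exact: quogrp_pi_nbhs.
- by rewrite -[b]reprK; exact: quogrp_pi_nbhs.
move=> _ [[v Vv <-] [w Ww /esym/quogrpP h]].
exact: (sVW (v, w) (conj Vv Ww)).
Qed.

HB.instance Definition _ := isTopGroup.Build quogrp
  quogrp_mulg_continuous quogrp_invg_continuous quogrp_hausdorff.

End Quotient.

Section FittingStructure.
Implicit Type G : topGroupType.

Definition trivial_group G : Prop := forall x : G, x = 1.

Definition normal_in G (H L : csubgroup G) : Prop :=
  H `<=` L /\ forall x h, csub_set L x -> csub_set H h -> csub_set H (h ^ x).

Inductive subnormal G : csubgroup G -> Prop :=
| subnormal_top (H : csubgroup G) : H = [set: G] :> set G -> subnormal H
| subnormal_step (H L : csubgroup G) :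
    subnormal L -> normal_in H L -> subnormal H.

(* [G : N] is a power of p for every open normal subgroup N. *)
Definition pro_p (p : nat) G : Prop :=
  forall N : nsubgroup G, open (N : set G) ->
  exists k : nat, ([set: quogrp N] #= `I_(p ^ k)%N)%card.

Definition pro_core (p : nat) G : csubgroup G :=
  gen (\bigcup_(N in [set N : nsubgroup G | pro_p p (subgrp N)]) (N : set G)).

Definition fitting G : csubgroup G :=
  gen (\bigcup_(p in [set p : nat | prime p]) (pro_core p G : set G)).

(* Perfectness in the topological sense: the commutators generate a dense
   subgroup. *)
Definition perfect G : Prop :=
  gen [set z : G | exists x y : G, z = [~ x, y]] = [set: G] :> set G.

Definition simple_group G : Prop :=
  ~ trivial_group G /\
  forall N : nsubgroup G, N = [set 1] :> set G \/ N = [set: G] :> set G.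

Definition quasisimple G : Prop :=
  perfect G /\ simple_group (quogrp (center G)).

Definition component G (Q : csubgroup G) : Prop :=
  subnormal Q /\ quasisimple (subgrp Q).

Definition layer G : csubgroup G :=
  gen (\bigcup_(Q in [set Q : csubgroup G | component Q]) (Q : set G)).

Definition gen_fitting G : csubgroup G :=
  gen ((fitting G : set G) `|` (layer G : set G)).

Definition fitting_degenerate G : Prop := gen_fitting G = [set 1] :> set G.

Definition fitting_regular G : Prop :=
  forall K : nsubgroup G,
  ~ trivial_group (quogrp K) -> ~ fitting_degenerate (quogrp K).

(* O^[FD](G). *)
Definition FD_residual G : nsubgroup G :=
  nsub_bigcap [set K : nsubgroup G | fitting_degenerate (quogrp K)].

(* O_[FR](G). *)
Definition FR_radical G : csubgroup G :=
  gen (\bigcup_(N in [set N : nsubgroup G | fitting_regular (subgrp N)])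
         (N : set G)).

(* Automorphisms are bicontinuous; g is the inverse of f. *)
Definition characteristic G (H : csubgroup G) : Prop :=
  forall f g : G -> G, cancel f g -> cancel g f ->
  {morph f : x y / x * y} -> continuous f -> continuous g ->
  f @` H = H.

End FittingStructure.

(* Main.v *)
(* A section B/A of G is handled inside G, as a pair of closed subgroups, so that
   every quotient of a subgroup of G that occurs is such a pair.

   Put R = O^[FD](G). Fitting-degeneracy passes to subnormal subgroups and to
   extensions, and G/K is Fitting-degenerate when K is an intersection of normal
   subgroups with this property; hence G/R is Fitting-degenerate, and R is
   Fitting-regular, since a Fitting-degenerate quotient R/K would make
   G / core(K) an extension of two Fitting-degenerate groups.

   The main point is that a normal subgroup N of a Fitting-regular group B is
   Fitting-regular. Factoring out O^[FD](N), let N be Fitting-degenerate, and let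
   C be its centralizer. Then N and C meet trivially (a nontrivial abelian
   profinite group has a nontrivial Sylow subgroup), and B/C is
   Fitting-degenerate, because normal pro-p subgroups and components of B/C meet
   the image of N trivially and so centralize it. Thus B = C and N = 1.

   For H open, take N normal open in G inside H, and T = O^[FD](N). Both O_[FR](G)
   and O_[FR](H) consist of the elements centralizing N/T: such elements form a
   finite group modulo T, and finite groups are Fitting-regular. *)
Require Import Defs.
From HB Require Import structures.
From mathcomp Require Import fingroup cyclic pgroup all_boot all_classical topology.

Set Implicit Arguments.
Unset Strict Implicit.
Unset Printing Implicit Defensive.

Local Open Scope classical_set_scope.
Local Open Scope quotient_scope.
Local Open Scope group_scope.

(** * Open normal subgroups of profinite groups *)


(** The sets K [&] f i form a filter base on the compact set K. A cluster point of this filter lies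
    in every [f i], because these are closed. *)
Lemma compact_directed (T : topologicalType) (I : Type) (D : set I)
    (f : I -> set T) (K : set T) :
  compact K -> D !=set0 -> (forall i, D i -> closed (f i)) ->
  (forall i j, D i -> D j -> exists2 k, D k & f k `<=` f i `&` f j) ->
  (forall i, D i -> K `&` f i !=set0) ->
  K `&` \bigcap_(i in D) f i !=set0.
Proof.
move=> cK [i0 Di0] cf dirf nf.
have FF : ProperFilter (filter_from D (fun i => K `&` f i)).
  apply: filter_from_proper => //; apply: filter_from_filter; first by exists i0.
  move=> i j Di Dj; have [k Dk sk] := dirf _ _ Di Dj; exists k => //.
  by move=> x [Kx /sk[fi fj]]; split; split.
have FK : filter_from D (fun i => K `&` f i) K by exists i0 => //; exact: subIsetl.
have [x [Kx clx]] := cK _ FF FK.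
exists x; split=> // i Di; have /closure_id -> := cf i Di.
move=> B nB; have [|y [[Ky fy] By]] := clx (K `&` f i) B _ nB; first by exists i.
by exists y.
Qed.

(** In a compact Hausdorff space the intersection Q of all clopen sets containing x is connected. If
    y could not be separated from x, it would lie in Q, hence in the connected component of x. *)
Lemma totally_disconnected_zero_dimensional (T : topologicalType) :
  hausdorff_space T -> compact [set: T] -> totally_disconnected [set: T] ->
  zero_dimensional T.
Proof.
move=> hT cT tdT x y /eqP xy; apply: contrapT => noU.
pose D := [set U : set T | clopen U /\ U x].
pose Q := \bigcap_(U in D) U.
have Qx : Q x by move=> U [].
have Qy : Q y.
  by move=> U [cU Ux]; apply: contrapT => nUy; apply: noU; exists U.
have cQ : closed Q by apply: closed_bigI => U [[]].
suff conQ : connected Q.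
  have : connected_component [set: T] x y by exists Q => //; split.
  by rewrite tdT // => yx; apply: xy.
move=> B [b Bb] [C oC BC] [E cE BE].
have cB : closed B by rewrite BE; exact: closedI.
have QnC : closed (Q `\` C) by apply: closedI => //; exact: open_closedC.
have nE : set_nbhs B (~` (Q `\` C)).
  apply/set_nbhsP; exists (~` (Q `\` C)).
  split=> //; first exact: closed_openC.
  by rewrite BC => z [_ Cz] [].
have [V nV sV] := @compact_normal T hT cT B cB _ nE.
have /set_nbhsP[U [oU BU UV]] := nV.
have clUV : closure U `<=` ~` (Q `\` C).
  by apply: subset_trans sV; exact: closureS.
(* By compactness a single clopen neighbourhood W of x misses the boundary of U. So U cuts W into
   two clopen parts, and Q lies in the part that contains x. *)
have [W [[oW cW] Wx] WK] : exists2 W, D W & W `&` (closure U `\` U) = set0.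
  apply: contrapT => nW.
  have [|||||z [[clz nUz] Qz]] :=
      @compact_directed T (set T) D id (closure U `\` U).
  - apply: (subclosed_compact _ cT) => //.
    by apply: closedI; [exact: closed_closure|exact: open_closedC].
  - by exists setT; split=> //; exact: clopenT.
  - by move=> U' [[]].
  - move=> W1 W2 [c1 x1] [c2 x2]; exists (W1 `&` W2) => //.
    by split; [exact: clopenI|].
  - move=> W DW; apply/set0P/eqP => W0; apply: nW; exists W => //.
    by rewrite setIC.
  apply: nUz; apply: BU; rewrite BC; split=> //.
  by apply: contrapT => nCz; exact: (clUV z clz).
have WE z : W z -> closure U z -> U z.
  move=> Wz clz; apply: contrapT => nUz.
  by have : set0 z by rewrite -WK.
have [Ux|nUx] := pselect (U x).
  apply/seteqP; split; first by rewrite BC; exact: subIsetl.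
  move=> z Qz; rewrite BC; split=> //; apply: contrapT => nCz.
  have [_ Uz] : (W `&` U) z.
    apply: Qz; split; last by split.
    split; first exact: openI.
    suff -> : W `&` U = W `&` closure U by apply: closedI => //; exact: closed_closure.
    apply/seteqP; split=> t [Wt Ut]; split=> //; first exact: subset_closure.
    exact: WE.
  by apply: (clUV z) => //; exact: subset_closure.
suff [_ []] : (W `&` ~` U) b by exact: BU.
have := Bb; rewrite BC => -[Qb _]; apply: Qb; split; last by split.
split; last by apply: closedI => //; exact: open_closedC.
suff -> : W `&` ~` U = W `&` ~` closure U.
  by apply: openI => //; apply: closed_openC; exact: closed_closure.
apply/seteqP; split=> t [Wt Ut]; split=> // clt; apply: Ut; first exact: WE.
exact: subset_closure.
Qed.

Section ProfiniteBasics.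
Variable G : topGroupType.

Lemma csubgroup_ext (H K : csubgroup G) : H = K :> set G -> H = K.
Proof.
case: H => H c1 o1 m1 v1; case: K => K c2 o2 m2 v2 /= e; subst K.
by congr CSubgroup; exact: Prop_irrelevance.
Qed.

Lemma csubJ (H : csubgroup G) x h : csub_set H x -> csub_set H h -> csub_set H (h ^ x).
Proof.
by move=> Hx Hh; rewrite conjgE; apply: csubM; [exact: csubV|exact: csubM].
Qed.

Lemma csubR (H : csubgroup G) x y : csub_set H x -> csub_set H y -> csub_set H [~ x, y].
Proof. by move=> Hx Hy; rewrite commgEl; apply: csubM; [exact: csubV|exact: csubJ]. Qed.

Lemma csubX (H : csubgroup G) x n : csub_set H x -> csub_set H (x ^+ n).
Proof.
move=> Hx; elim: n => [|n IH]; first by rewrite expg0; exact: csub1.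
by rewrite expgS; exact: csubM.
Qed.

Lemma id_continuous : continuous (fun x : G => x).
Proof. by move=> x. Qed.

(** Tube lemma. Together with [openN_basis] it gives an open normal M with KM inside V. *)
Lemma mulg_tube (K V : set G) : compact K -> open V -> K `<=` V ->
  \forall u \near (1 : G), forall a, K a -> V (a * u).
Proof.
move=> /compact_near_coveringP cK oV KV.
apply: (cK _ _ (fun u a => V (a * u))) => a Ka.
have nV : nbhs (a * 1) V.
  by rewrite mulg1; apply: open_nbhs_nbhs; split=> //; exact: KV.
exact: (@mulg_continuous G (a, 1) V nV).
Qed.

Lemma translate_continuous (a : G) : continuous (fun x : G => a * x).
Proof. by apply: continuousM; [exact: cst_continuous|exact: id_continuous]. Qed.

Lemma open_subgroup_closed (W : set G) : open W ->
  (forall x y, W x -> W y -> W (x * y)) -> (forall x, W x -> W x^-1) -> W 1 -> closed W.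
Proof.
move=> oW WM WV W1.
rewrite -openC; suff -> : ~` W = \bigcup_(x in ~` W) (fun y => x^-1 * y) @^-1` W.
  apply: bigcup_open => x _; apply: open_comp oW => + _; exact: translate_continuous.
apply/seteqP; split=> [x nx|y [x nx Wxy] Wy]; first by exists x => //=; rewrite mulVg.
by apply: nx; have := WM _ _ Wy (WV _ Wxy); rewrite /= invgM invgK mulVKg.
Qed.

Hypothesis profG : profinite G.

Lemma closed_compact (A : set G) : closed A -> compact A.
Proof. by move=> cA; apply: (subclosed_compact cA profG.1). Qed.

(** Take a clopen W inside U containing 1. The elements that can be inserted into any product a b
    without changing its membership in W form a normal subgroup N, and a = b = 1 shows that N lies
    in W. *)
Lemma openN_basis (U : set G) : nbhs 1 U ->
  exists2 M : nsubgroup G, open (M : set G) & (M : set G) `<=` U.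
Proof.
move=> nU.
have zd := totally_disconnected_zero_dimensional
  (@topgroup_hausdorff G) profG.1 profG.2.
have [W [W1 [oW cW]] WU] :=
  @zero_dimensional_cvg G 1 (@topgroup_hausdorff G) zd profG.1 _ nU.
pose N := [set x : G | forall a b, W (a * b) <-> W (a * x * b)].
have N1 : N 1 by move=> a b; rewrite mulg1.
have NM x y : N x -> N y -> N (x * y).
  move=> Nx Ny a b; rewrite (Nx a b) -!mulgA mulgA (Ny (a * x) b).
  by rewrite !mulgA.
have NV x : N x -> N x^-1.
  by move=> Nx a b; have := Nx (a * x^-1) b; rewrite mulgVK => <-.
have NJ x k : N k -> N (k ^ x).
  move=> Nk a b; have := Nk (a * x^-1) (x * b).
  by rewrite conjgE !mulgA mulgVK.
have oN : open N.
  have nN1 : nbhs 1 N.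
    (* Both W and its complement are open, so near each (a, b) every small u satisfies P;
       compactness of the space of pairs makes the bound on u uniform. *)
    pose P (u : G) (ab : G * G) := W (ab.1 * ab.2) <-> W (ab.1 * u * ab.2).
    have cGG : compact [set: G * G].
      by have := compact_setX profG.1 profG.1; rewrite setXTT.
    have : \forall u \near (1 : G), [set: G * G] `<=` P u.
      apply: (iffLR (compact_near_coveringP _) cGG) => -[a b] _; rewrite /P.
      pose f1 (z : (G * G) * G) := z.1.1 * z.1.2.
      pose f2 (z : (G * G) * G) := z.1.1 * z.2 * z.1.2.
      have c11 : continuous (fun z : (G * G) * G => z.1.1).
        move=> z; apply: (@continuous_comp _ _ _ fst fst); exact: cvg_fst.
      have c12 : continuous (fun z : (G * G) * G => z.1.2).
        move=> z; apply: (@continuous_comp _ _ _ fst snd); [exact: cvg_fst|exact: cvg_snd].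
      have c2 : continuous (fun z : (G * G) * G => z.2) by move=> z; exact: cvg_snd.
      have cf1 : continuous f1 by exact: continuousM.
      have cf2 : continuous f2 by apply: continuousM => //; exact: continuousM.
      have [Wab|nWab] := pselect (W (a * b)).
        have n1 : nbhs ((a, b), (1 : G)) (f1 @^-1` W).
          by apply: cf1; exact: open_nbhs_nbhs.
        have n2 : nbhs ((a, b), (1 : G)) (f2 @^-1` W).
          by apply: cf2; apply: open_nbhs_nbhs; rewrite /f2 /= mulg1.
        by apply: filterS (filterI n1 n2) => -[[a' b'] u] [] /=.
      have oW' : open (~` W) by exact: closed_openC.
      have n1 : nbhs ((a, b), (1 : G)) (f1 @^-1` (~` W)).
        by apply: cf1; exact: open_nbhs_nbhs.
      have n2 : nbhs ((a, b), (1 : G)) (f2 @^-1` (~` W)).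
        by apply: cf2; apply: open_nbhs_nbhs; rewrite /f2 /= mulg1.
      by apply: filterS (filterI n1 n2) => -[[a' b'] u] [] /=.
    by apply: filterS => u Pu a b; exact: (Pu (a, b) I).
  rewrite openE => x Nx; rewrite /interior.
  have nx : nbhs x ((fun y => x^-1 * y) @^-1` N).
    by apply: translate_continuous; rewrite mulVg.
  by apply: filterS nx => y /= Ny; rewrite -(mulVKg x y); exact: NM.
have cN := open_subgroup_closed oN NM NV N1.
pose Ms := @CSubgroup G N cN N1 NM NV.
exists (@NSubgroup G Ms NJ) => //= x /(_ 1 1).
by rewrite !mulg1 mul1g => /iffLR/(_ W1) /WU.
Qed.

End ProfiniteBasics.

(** * Presentations of sections *)


Section ClosedSubgroups.
Variable G : topGroupType.

Program Definition csubT : csubgroup G :=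
  @CSubgroup G [set: G] (@closedT G) _ _ _.
Next Obligation. by []. Qed.
Next Obligation. by []. Qed.
Next Obligation. by []. Qed.

Program Definition csub_triv : csubgroup G :=
  @CSubgroup G [set 1] (@topgroup_closed1 G) _ _ _.
Next Obligation. by []. Qed.
Next Obligation. by move=> x y -> ->; rewrite /= mulg1. Qed.
Next Obligation. by move=> x ->; rewrite /= invg1. Qed.

Program Definition csubI (H K : csubgroup G) : csubgroup G :=
  @CSubgroup G (H `&` K) _ _ _ _.
Next Obligation. by move=> H K; apply: closedI; exact: csub_closed. Qed.
Next Obligation. by move=> H K; split; exact: csub1. Qed.
Next Obligation. by move=> H K x y [Hx Kx] [Hy Ky]; split; exact: csubM. Qed.
Next Obligation. by move=> H K x [Hx Kx]; split; exact: csubV. Qed.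

Definition join (H K : csubgroup G) : csubgroup G := gen ((H : set G) `|` K).

Lemma gen_sub (S : set G) : S `<=` gen S.
Proof. by move=> x Sx H; apply. Qed.

Lemma gen_min (S : set G) (H : csubgroup G) : S `<=` H -> gen S `<=` H.
Proof. by move=> SH x; apply. Qed.

Lemma csub_eqP (H K : csubgroup G) : (H : set G) `<=` K -> (K : set G) `<=` H -> H = K.
Proof. by move=> HK KH; apply: csubgroup_ext; apply/seteqP. Qed.

Definition nsub_of (H : csubgroup G) (nH : normal_in H csubT) : nsubgroup G :=
  @NSubgroup G H (fun x k Hk => nH.2 x k I Hk).

Lemma nsub_normalT (K : nsubgroup G) : normal_in K csubT.
Proof. by split=> // x h _; exact: nsub_normal. Qed.

End ClosedSubgroups.
Arguments csub_triv {G}.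
Arguments csubT {G}.

Lemma closed_preimage (X Y : topologicalType) (f : X -> Y) (D : set Y) :
  continuous f -> closed D -> closed (f @^-1` D).
Proof. by move=> cf; apply: preimage_closed => x _; exact: cf. Qed.

Lemma subgrp_closedP (X : topGroupType) (L : csubgroup X) (D : set (subgrp L)) :
  closed D -> exists2 D0 : set X, closed D0 & D = val @^-1` D0.
Proof.
rewrite -openC => -[A oA AD]; exists (~` A); first exact: open_closedC.
by rewrite -[D]setCK -AD.
Qed.

Lemma subgrp_valM (X : topGroupType) (L : csubgroup X) (x y : subgrp L) :
  val (x * y) = val x * val y.
Proof. by rewrite gmulfM. Qed.

Lemma subgrp_val1 (X : topGroupType) (L : csubgroup X) :
  val (1 : subgrp L) = 1.
Proof. by rewrite gmulf1. Qed.

Lemma subgrp_valP (X : topGroupType) (L : csubgroup X) (x : subgrp L) :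
  csub_set L (val x).
Proof. exact/set_mem/(valP x). Qed.

Section SectionMaps.
Variable G : topGroupType.

(* Presents X as the section B/A of G through a map h that is only meaningful
   on B. *)
Record secmap (A B : csubgroup G) (X : topGroupType) (h : G -> X) : Prop :=
  SecMap {
  sm_sub : (A : set G) `<=` B;
  smM : forall x y, csub_set B x -> csub_set B y -> h (x * y) = h x * h y;
  sm_ker : forall x, csub_set B x -> (h x = 1 <-> csub_set A x);
  sm_surj : forall y, exists2 x, csub_set B x & h x = y;
  sm_pre : forall D, closed D -> closed ((B : set G) `&` h @^-1` D);
  sm_img : forall C, closed C -> C `<=` B -> closed (h @` C);
  sm_compact : compact [set: X] }.

Section OneMap.
Variables (A B : csubgroup G) (X : topGroupType) (h : G -> X).
Hypothesis s : secmap A B h.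

Lemma sm1 : h 1 = 1.
Proof. by apply/(sm_ker s); exact: csub1. Qed.

Lemma smV x : csub_set B x -> h x^-1 = (h x)^-1.
Proof.
move=> Bx; apply: (@mulgI _ (h x)).
by rewrite -(smM s) ?mulgV ?sm1 //; exact: csubV.
Qed.

Lemma smX x n : csub_set B x -> h (x ^+ n) = h x ^+ n.
Proof.
move=> Bx; elim: n => [|n IH]; first by rewrite !expg0 sm1.
by rewrite !expgS (smM s) ?IH //; exact: csubX.
Qed.

Lemma smJ x y : csub_set B x -> csub_set B y -> h (x ^ y) = h x ^ h y.
Proof.
move=> Bx By; have BV := csubV By; rewrite !conjgE.
by rewrite !(smM s, smV) //; exact: csubM.
Qed.

Lemma smR x y : csub_set B x -> csub_set B y -> h [~ x, y] = [~ h x, h y].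
Proof.
move=> Bx By; have BV := csubV Bx; rewrite !commgEl.
by rewrite (smM s) ?smV ?smJ //; exact: csubJ.
Qed.

Program Definition pull (L : csubgroup X) : csubgroup G :=
  @CSubgroup G ((B : set G) `&` h @^-1` L) _ _ _ _.
Next Obligation. by move=> L; apply: (sm_pre s); exact: csub_closed. Qed.
Next Obligation. by move=> L; split; [|rewrite /= sm1]; exact: csub1. Qed.
Next Obligation.
move=> L x y [Bx Lx] [By Ly]; split; first exact: csubM.
by rewrite /= (smM s) //; exact: csubM.
Qed.
Next Obligation.
by move=> L x [Bx Lx]; split; rewrite /= ?smV //; exact: csubV.
Qed.

Lemma pull_sub L : (pull L : set G) `<=` B. Proof. by move=> x []. Qed.

Lemma pull_ker L : (A : set G) `<=` pull L.
Proof.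
move=> x Ax; have Bx := sm_sub s Ax; split=> //=.
by rewrite (sm_ker s Bx).2 //; exact: csub1.
Qed.

(** Correspondence theorem: with [pull_subset], the closed subgroups of X match those between A and
    B. The image of M is closed by [sm_img]. *)
Lemma pull_push (M : csubgroup G) : (A : set G) `<=` M -> (M : set G) `<=` B ->
  exists L, pull L = M.
Proof.
move=> AM MB.
have cL : closed (h @` M) by apply: (sm_img s) => //; exact: csub_closed.
have L1 : (h @` M) 1 by exists 1; [exact: csub1|exact: sm1].
have LM x y : (h @` M) x -> (h @` M) y -> (h @` M) (x * y).
  move=> [a Ma <-] [b Mb <-]; exists (a * b); first exact: csubM.
  by apply: (smM s); exact: MB.
have LV x : (h @` M) x -> (h @` M) x^-1.
  by move=> [a Ma <-]; exists a^-1; [exact: csubV|apply/smV/MB].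
exists (CSubgroup cL L1 LM LV); apply: csub_eqP => [x [Bx [m Mm hm]]|x Mx].
  rewrite -(mulVKg m x); apply: csubM => //; apply: AM.
  have Bm := MB _ Mm; have BmV := csubV Bm.
  by apply/(sm_ker s); [exact: csubM|rewrite (smM s) // smV // hm mulVg].
by split; [exact: MB|exists x].
Qed.

Lemma pull_subset L1 L2 :
  (pull L1 : set G) `<=` pull L2 <-> (L1 : set X) `<=` L2.
Proof.
split=> [h12 y|h12 x [Bx]]; last by move=> /h12.
by have [x Bx <-] := sm_surj s y => L1x; have [] := h12 x (conj Bx L1x).
Qed.

Lemma pullT L : (B : set G) `<=` pull L <-> L = [set: X] :> set X.
Proof.
split=> [BL|LT x Bx]; last by split; rewrite //= LT.
apply/seteqP; split=> // y _; have [x Bx <-] := sm_surj s y.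
by have [] := BL x Bx.
Qed.

Lemma pull1 L : (pull L : set G) `<=` A <-> L = [set 1] :> set X.
Proof.
split=> [LA|L1 x [Bx]]; last by rewrite /= L1 => /(sm_ker s Bx).
apply/seteqP; split=> [y|_ ->]; last exact: csub1.
have [x Bx <-] := sm_surj s y => Lx.
by apply/(sm_ker s Bx); apply: LA.
Qed.

Lemma pull_normal L1 L2 :
  normal_in (pull L1) (pull L2) <-> normal_in L1 L2.
Proof.
split=> -[sub nor]; split; first exact/pull_subset.
- move=> x y; have [a Ba <-] := sm_surj s x; have [b Bb <-] := sm_surj s y.
  by move=> L2a L1b; have [_] := nor a b (conj Ba L2a) (conj Bb L1b); rewrite /= smJ.
- exact/pull_subset.
- move=> x y [Bx Lx] [By Ly]; split; first exact: csubJ.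
  by rewrite /= smJ //; exact: nor.
Qed.

Lemma pullB : pull csubT = B.
Proof. by apply: csub_eqP => x; [case|split]. Qed.

End OneMap.

(** The default value 1 of [insubd] is taken only when h g is outside L, which does not happen on
    [pull s L]. *)
Lemma secmap_sub A B (X : topGroupType) (h : G -> X) (s : secmap A B h) (L : csubgroup X) :
  secmap A (pull s L) (fun g => insubd (1 : subgrp L) (h g)).
Proof.
have valh g : csub_set L (h g) -> val (insubd (1 : subgrp L) (h g)) = h g.
  by move=> Lg; rewrite insubdK //; exact/mem_set.
have preE (D0 : set X) : (pull s L : set G) `&`
    (fun g => insubd (1 : subgrp L) (h g)) @^-1` (val @^-1` D0) =
    (pull s L : set G) `&` ((B : set G) `&` h @^-1` D0).
  by apply/seteqP; split=> x [[Bx Lx]] /=; rewrite valh // => -[].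
split.
- exact: pull_ker.
- move=> x y [Bx Lx] [By Ly]; apply: val_inj.
  have Lxy : csub_set L (h (x * y)) by rewrite (smM s) //; exact: csubM.
  by rewrite subgrp_valM !valh // (smM s).
- move=> x [Bx Lx]; rewrite -(sm_ker s Bx); split=> [e|e].
    by rewrite -valh // e subgrp_val1.
  by apply: val_inj; rewrite valh // e subgrp_val1.
- move=> y; have [x Bx hx] := sm_surj s (val y).
  have Lx : csub_set L (h x) by rewrite hx; exact: subgrp_valP.
  by exists x => //; apply: val_inj; rewrite valh.
- move=> D /subgrp_closedP[D0 cD0 ->]; rewrite preE.
  by apply: closedI; [exact: csub_closed|exact: (sm_pre s)].
- move=> C cC CL.
  have -> : (fun g => insubd (1 : subgrp L) (h g)) @` C = val @^-1` (h @` C).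
    apply/seteqP; split=> [_ [x Cx <-]|y [x Cx hx]].
      by exists x => //; rewrite valh //; have [] := CL x Cx.
    by exists x => //; apply: val_inj; rewrite valh //; have [] := CL x Cx.
  apply: closed_preimage; first exact: subgrp_val_continuous.
  by apply: (sm_img s) => // x /CL[].
(* A filter on [subgrp L] is pushed forward to X; it clusters at a point of the compact set L. *)
- have cL : compact (L : set X) by apply: (subclosed_compact (csub_closed (c := L)) (sm_compact s)).
  move=> F FF _.
  have FL : (val @ F) L.
    by apply: (@filterS _ F _ setT) => [y _|]; [exact: (subgrp_valP y)|exact: filterT].
  have [x [Lx clx]] := cL _ (fmap_proper_filter val FF) FL.
  pose y := insubd (1 : subgrp L) x.
  have vy : val y = x by rewrite insubdK //; exact/mem_set.
  exists y; split=> // U V FU; rewrite nbhsE => -[W [[W0 oW0 <-] Wy] WV].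
  have FvU : (val @ F) (val @` U) by apply: (@filterS _ F _ U) => // u Uu; exists u.
  have nW0 : nbhs x W0 by apply: open_nbhs_nbhs; split=> //; rewrite -vy.
  have [z [[u Uu <-] Wu]] := clx _ _ FvU nW0.
  by exists u; split=> //; apply: WV.
Qed.

Lemma secmap_quo A B (X : topGroupType) (h : G -> X) (s : secmap A B h) (K : nsubgroup X) :
  secmap (pull s K) B (fun g => \pi_(quogrp K) (h g)).
Proof.
have pc := @quogrp_pi_continuous X K.
have cX : compact [set: quogrp K].
  have -> : [set: quogrp K] = \pi_(quogrp K) @` [set: X].
    by apply/seteqP; split=> // y _; exists (repr y) => //; rewrite reprK.
  apply: continuous_compact; last exact: (sm_compact s).
  by move=> x; exact/continuous_subspaceT.
split=> //.
- exact: pull_sub.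
- by move=> x y Bx By; rewrite (smM s) // quogrp_piM.
- move=> x Bx; have -> : (1 : quogrp K) = \pi_(quogrp K) 1 by [].
  split=> [/quogrpP|[_ Kx]].
    by rewrite mulg1 => /csubV; rewrite invgK.
  by apply/quogrpP; rewrite mulg1; exact: csubV.
- by move=> y; have [x Bx hx] := sm_surj s (repr y); exists x; rewrite // hx reprK.
- by move=> D cD; apply: (sm_pre s (D := \pi_(quogrp K) @^-1` D)); exact: closed_preimage.
- move=> C cC CB.
  have -> : (fun g => \pi_(quogrp K) (h g)) @` C = \pi_(quogrp K) @` (h @` C).
    by rewrite image_comp.
  apply: compact_closed; first exact: topgroup_hausdorff.
  apply: continuous_compact; first by move=> x; exact/continuous_subspaceT.
  by apply: (subclosed_compact _ (sm_compact s)) => //; exact: (sm_img s).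
Qed.

Lemma secmap_id : compact [set: G] -> secmap csub_triv csubT (fun x : G => x).
Proof.
move=> cG; split=> //.
- by move=> y; exists y.
- by move=> D cD; rewrite setTI.
- by move=> C cC _; rewrite image_id.
Qed.

End SectionMaps.

(** * Finite groups *)


(** The enumeration is carried by the type, so that a finite-group structure can be attached to it
    and Lagrange and Cauchy become available. *)
Definition finite_group_of (Q : groupType) (s : seq Q) (sP : forall x, x \in s) : Type := Q.

Section FiniteGroupOf.
Variables (Q : groupType) (s : seq Q) (sP : forall x, x \in s).
Local Notation T := (finite_group_of sP).

HB.instance Definition _ := Group.on T.

Lemma index_onthK : pcancel (fun x : T => index x s) (onth s).
Proof. by move=> x; rewrite onthE (nth_map x) ?nth_index ?index_mem ?sP. Qed.

HB.instance Definition _ := isCountable.Build T index_onthK.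

Lemma undup_enumP : @Finite.axiom T (undup s).
Proof. by move=> x; rewrite count_uniq_mem ?undup_uniq // mem_undup sP. Qed.

HB.instance Definition _ := isFinite.Build T undup_enumP.
End FiniteGroupOf.

Lemma card_finite_group (T : finType) : ([set: T] #= `I_#|T|)%card.
Proof.
rewrite card_eq_sym; apply: (card_eq_trans card_II).
have <- : (@enum_val T predT) @` [set: 'I_#|T|] = [set: T].
  apply/seteqP; split=> // x _; exists (enum_rank x) => //; exact: enum_rankK.
rewrite card_eq_sym; apply: inj_card_eq => i j _ _; exact: enum_val_inj.
Qed.

(** Lagrange: the order of x divides the order of the group. *)
Lemma finite_group_expg (Q : groupType) n : ([set: Q] #= `I_n)%card ->
  forall x : Q, x ^+ n = 1.
Proof.
move=> cQ x; have /finite_seqP[s sE] : finite_set [set: Q] by apply/finite_setP; exists n.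
have sP y : y \in s by have : [set: Q] y by []; rewrite sE.
pose T : fingroup.FinGroup.type := finite_group_of sP.
have -> : n = #|T|.
  by apply/card_eq_II; apply: card_eq_trans (card_finite_group T); rewrite card_eq_sym.
have := cyclic.order_dvdG (finset.in_setT (x : T)).
by rewrite cyclic.order_dvdn finset.cardsT => /eqP.
Qed.

(** Cauchy: a prime q dividing the order is the order of some x, so q divides a power of p. *)
Lemma finite_pgroup_card (Q : groupType) p : prime p -> finite_set [set: Q] ->
  (forall x : Q, exists k, x ^+ (p ^ k)%N = 1) ->
  exists k, ([set: Q] #= `I_(p ^ k)%N)%card.
Proof.
move=> pp /finite_seqP[s sE] pQ.
have sP y : y \in s by have : [set: Q] y by []; rewrite sE.
pose T : fingroup.FinGroup.type := finite_group_of sP.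
suff [k ek] : exists k, #|T| = (p ^ k)%N.
  by exists k; rewrite -ek; exact: (card_finite_group T).
have T0 : (0 < #|T|)%N by apply/card_gt0P; exists (1 : Q).
suff /p_natP[k ->] : pnat (p : nat_pred) #|T| by exists k.
apply/pnatP => // q qq; rewrite -finset.cardsT => /(pgroup.Cauchy qq)[x _ ox].
have [k xk] := pQ x.
have : (q %| p ^ k)%N by rewrite -ox cyclic.order_dvdn; apply/eqP.
by rewrite Euclid_dvdX // dvdn_prime2 // => /andP[].
Qed.

(** * Fitting-degenerate sections *)


Section Sections.
Variable G : topGroupType.
Hypothesis profG : profinite G.
Implicit Types A B C H K L M N Q R : csubgroup G.

(** B is presented first, as a subgroup of G; then the normal subgroup of it that pulls back to A is
    factored out. *)
Lemma secmap_section A B : normal_in A B ->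
  exists (X : topGroupType) (h : G -> X), secmap A B h.
Proof.
move=> nAB; have s0 := secmap_id profG.1.
have e : pull s0 B = B by apply: csub_eqP => x; [case|split].
have := secmap_sub s0 B; rewrite e.
set h := (X in secmap _ _ X) => s1.
have [|L eL] := pull_push s1 _ nAB.1; first by move=> _ ->; exact: csub1.
have nL : normal_in L csubT by apply/(pull_normal s1); rewrite eL pullB.
have := secmap_quo s1 (nsub_of nL); rewrite [pull _ _]eL => s2.
by eexists; eexists; exact: s2.
Qed.

Lemma sm_eq A B (X : topGroupType) (h : G -> X) (s : secmap A B h) x y :
  csub_set B x -> csub_set B y -> h x = h y <-> csub_set A (x^-1 * y).
Proof.
move=> Bx By; have BV := csubV Bx.
rewrite -(sm_ker s) ?(smM s) ?(smV s) //; last exact: csubM.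
split=> [->|e]; first by rewrite mulVg.
by apply: (@mulgI _ (h x)^-1); rewrite e mulVg.
Qed.

Lemma sm_comm A B (X : topGroupType) (h : G -> X) (s : secmap A B h) x y :
  csub_set B x -> csub_set B y -> csub_set A [~ x, y] <-> commute (h x) (h y).
Proof.
move=> Bx By; rewrite -(sm_ker s) ?(smR s) //; last exact: csubR.
by split=> [/eqP/commgP|/commgP/eqP].
Qed.

Lemma closed_mul (S T : set G) : closed S -> closed T ->
  closed [set z | exists x y, [/\ S x, T y & z = x * y]].
Proof.
move=> cS cT.
have -> : [set z | exists x y, [/\ S x, T y & z = x * y]] =
    (fun xy : G * G => xy.1 * xy.2) @` (S `*` T).
  apply/seteqP; split=> [_ [x [y [Sx Ty ->]]]|_ [[x y] [/= Sx Ty] <-]].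
    by exists (x, y).
  by exists x, y.
apply: compact_closed; first exact: topgroup_hausdorff.
apply: continuous_compact.
  by move=> x; apply/continuous_subspaceT; exact: mulg_continuous.
by apply: compact_setX; exact: closed_compact.
Qed.

Lemma join_l H K : (H : set G) `<=` join H K.
Proof. by move=> x Hx; apply: gen_sub; left. Qed.

Lemma join_r H K : (K : set G) `<=` join H K.
Proof. by move=> x Hx; apply: gen_sub; right. Qed.

Lemma join_min H K L : (H : set G) `<=` L -> (K : set G) `<=` L ->
  (join H K : set G) `<=` L.
Proof. by move=> HL KL; apply: gen_min => x []; [exact: HL|exact: KL]. Qed.

(** As K is normal, the products h k form a subgroup, and compactness makes it closed; so the
    topological join is just HK. *)
Lemma joinP H K B x : normal_in K B -> (H : set G) `<=` B ->
  csub_set (join H K) x ->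
  exists h k, [/\ csub_set H h, csub_set K k & x = h * k].
Proof.
move=> nKB HB.
pose S := [set z | exists h k, [/\ csub_set H h, csub_set K k & z = h * k]].
have cS : closed S by apply: closed_mul; exact: csub_closed.
have S1 : S 1 by exists 1, 1; split; rewrite ?mulg1 //; exact: csub1.
have SM y z : S y -> S z -> S (y * z).
  move=> [h [k [Hh Kk ->]]] [h' [k' [Hh' Kk' ->]]].
  exists (h * h'), (k ^ h' * k'); split; first exact: csubM.
    by apply: csubM => //; apply: nKB.2 => //; exact: HB.
  by rewrite conjgE -!mulgA !mulVKg.
have SV y : S y -> S y^-1.
  move=> [h [k [Hh Kk ->]]]; exists h^-1, (k^-1 ^ h^-1); split; first exact: csubV.
    by apply: nKB.2; [exact/HB/csubV|exact: csubV].
  by rewrite invgM conjgC.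
suff /(_ x) : (join H K : set G) `<=` CSubgroup cS S1 SM SV by [].
apply: join_min => y Hy /=.
  by exists y, 1; split; rewrite ?mulg1 //; exact: csub1.
by exists 1, y; split; rewrite ?mul1g //; exact: csub1.
Qed.

Lemma normal_refl B : normal_in B B.
Proof. by split=> // x h; exact: csubJ. Qed.

Lemma normal_sub H L B : normal_in H B -> (H : set G) `<=` L ->
  (L : set G) `<=` B -> normal_in H L.
Proof. by move=> [_ nH] HL LB; split=> // x h /LB; exact: nH. Qed.

Lemma normalI H L B : normal_in H L -> (B : set G) `<=` L -> normal_in (csubI H B) B.
Proof.
move=> [_ nH] BL; split; first by move=> x [].
by move=> x h Bx [Hh Bh]; split; [apply: nH => //; exact: BL|exact: csubJ].
Qed.

Lemma join_normal H L K B : normal_in H L -> (L : set G) `<=` B -> normal_in K B ->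
  normal_in (join H K) (join L K).
Proof.
move=> nHL LB nKB; split.
  apply: join_min; last exact: join_r.
  by apply: subset_trans (@join_l L K); exact: nHL.1.
move=> x y /(joinP nKB LB)[l [k [Ll Kk ->]]].
have HB := subset_trans nHL.1 LB.
move=> /(joinP nKB HB)[h [k' [Hh Kk' ->]]]; rewrite conjgM.
apply: csubJ; first exact: join_r.
rewrite conjMg; apply: csubM; first by apply/join_l/nHL.2.
by apply/join_r/nKB.2 => //; exact: LB.
Qed.

Lemma join_absorb K B : (K : set G) `<=` B -> join B K = B.
Proof. by move=> KB; apply: csub_eqP; [exact: join_min|exact: join_l]. Qed.

Lemma csubI_absorb H B : (H : set G) `<=` B -> csubI H B = H.
Proof. by move=> HB; apply: csub_eqP => [x []|x Hx] //; split=> //; exact: HB. Qed.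

Inductive subnormal_in B : csubgroup G -> Prop :=
| subnormal_in_refl : subnormal_in B B
| subnormal_in_step H L : subnormal_in B L -> normal_in H L -> subnormal_in B H.

Lemma subnormal_in_sub B H : subnormal_in B H -> (H : set G) `<=` B.
Proof. by elim=> // {}H L _ LB [HL _]; exact: subset_trans LB. Qed.

Lemma subnormal_in_normal B H : normal_in H B -> subnormal_in B H.
Proof. by apply: subnormal_in_step; exact: subnormal_in_refl. Qed.

Lemma subnormal_in_trans B L H : subnormal_in B L -> subnormal_in L H -> subnormal_in B H.
Proof. by move=> BL; elim=> // {}H L' _ IH; exact: subnormal_in_step. Qed.

Lemma subnormal_in_cap B Q L : subnormal_in B Q -> (L : set G) `<=` B -> subnormal_in L (csubI Q L).
Proof.
move=> sQ LB; elim: sQ => [|H L' _ IH nHL].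
  have -> : csubI B L = L by apply: csub_eqP => [x []|x Lx] //; split=> //; exact: LB.
  exact: subnormal_in_refl.
apply: subnormal_in_step IH _; split; first by move=> x [/nHL.1 L'x Lx].
by move=> x h [L'x Lx] [Hh Lh]; split; [exact: nHL.2|exact: csubJ].
Qed.

Lemma subnormal_in_restrict B Q L : subnormal_in B Q -> (L : set G) `<=` B ->
  (Q : set G) `<=` L -> subnormal_in L Q.
Proof. by move=> sQ LB QL; have := subnormal_in_cap sQ LB; rewrite csubI_absorb. Qed.

Lemma subnormal_in_join B H Q K : normal_in K B -> (H : set G) `<=` B -> subnormal_in H Q ->
  subnormal_in (join H K) (join Q K).
Proof.
move=> nKB HB; elim=> [|Q' L sL IH nQL]; first exact: subnormal_in_refl.
apply: subnormal_in_step IH _; apply: join_normal nKB => //.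
by apply: subset_trans HB; exact: subnormal_in_sub.
Qed.

(* x has p-power order modulo A, in the topological sense. *)
Definition ppow (p : nat) A (x : G) : Prop :=
  forall V : set G, open V -> (A : set G) `<=` V -> exists k, V (x ^+ (p ^ k)%N).

Lemma ppow_mono p A K x : (A : set G) `<=` K -> ppow p A x -> ppow p K x.
Proof. by move=> AK px V oV KV; apply: px => //; exact: subset_trans KV. Qed.

Lemma ppow_mem p A x : csub_set A x -> ppow p A x.
Proof. by move=> Ax V _ AV; exists 0%N; rewrite expn0 expg1; exact: AV. Qed.

(** All powers of x stay in N, so adding the open complement of N to V is harmless and turns a
    neighbourhood of the intersection into one of A. *)
Lemma ppow_capl p A N x : csub_set N x -> ppow p A x -> ppow p (csubI A N) x.
Proof.
move=> Nx px V oV ANV.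
have oV' : open (V `|` ~` (N : set G)).
  by apply: openU => //; apply: closed_openC; exact: csub_closed.
have [|k [//|]] := px _ oV'.
  move=> a Aa; have [Na|] := pselect (csub_set N a); last by right.
  by left; exact: ANV.
  by exists k.
by move=> nN; case: nN; exact: csubX.
Qed.

Lemma open_translates (S : set G) (M : nsubgroup G) : open (M : set G) ->
  open [set x | exists2 a, S a & csub_set M (a^-1 * x)].
Proof.
move=> oM; have -> : [set x | exists2 a, S a & csub_set M (a^-1 * x)] =
    \bigcup_(a in S) (fun x => a^-1 * x) @^-1` M.
  by apply/seteqP; split=> x [a Sa Max]; exists a.
apply: bigcup_open => a _; apply: open_comp oM => + _.
exact: translate_continuous.
Qed.

(** It is enough to test the neighbourhoods AM with M open normal: A is compact, so every open V
    around A contains one. *)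
Lemma ppowP p A x : ppow p A x <-> forall M : nsubgroup G, open (M : set G) ->
  exists k, exists2 a, csub_set A a & csub_set M (a^-1 * x ^+ (p ^ k)%N).
Proof.
split=> [px M oM|px V oV AV].
  apply: (px _ (open_translates A oM)) => a Aa.
  by exists a => //; rewrite mulVg; exact: csub1.
have := mulg_tube (closed_compact profG (csub_closed (c := A))) oV AV.
move=> /(openN_basis profG)[M oM MV]; have [k [a Aa Max]] := px M oM.
by exists k; have := MV _ Max a Aa; rewrite mulVKg.
Qed.

(** Since h is meaningful on B only, both directions pass to complements taken in B. These are
    closed, as [sm_pre] and [sm_img] require. *)
Lemma ppow_secmap p A B (X : topGroupType) (h : G -> X) (s : secmap A B h) x :
  csub_set B x -> ppow p A x <->
  forall U : set X, open U -> U 1 -> exists k, U (h x ^+ (p ^ k)%N).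
Proof.
move=> Bx; split=> [px U oU U1|px V oV AV].
  have [||k /not_andP[|]] := px (~` ((B : set G) `&` h @^-1` (~` U))).
  - by apply/closed_openC/(sm_pre s)/open_closedC.
  - by move=> a Aa [Ba /=]; rewrite (sm_ker s Ba).2 //; apply.
  - by case; exact: csubX.
  - by rewrite /= (smX s) // => /contrapT Uk; exists k.
have cC : closed (h @` ((B : set G) `&` ~` V)).
  apply: (sm_img s) => [|y []//].
  by apply: closedI; [exact: csub_closed|exact: open_closedC].
have [||k nk] := px (~` (h @` ((B : set G) `&` ~` V))).
- exact: closed_openC.
- by move=> [c [Bc nVc]] /(sm_ker s Bc)/AV.
exists k; apply: contrapT => nV; apply: nk; exists (x ^+ (p ^ k)%N).
  by split=> //; exact: csubX.
exact: (smX s).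
Qed.

(* Q/A is quasisimple. *)
Definition qs_section A Q : Prop :=
  [/\ ~ (forall x y, csub_set Q x -> csub_set Q y -> csub_set A [~ x, y]),
      forall L, (A : set G) `<=` L ->
        (forall x y, csub_set Q x -> csub_set Q y -> csub_set L [~ x, y]) ->
        (Q : set G) `<=` L &
      forall M, (A : set G) `<=` M -> normal_in M Q -> (Q : set G) `<=` M \/
        (forall x y, csub_set M x -> csub_set Q y -> csub_set A [~ x, y])].

(* B/A is Fitting-degenerate. *)
Definition FD_section A B : Prop :=
  (forall p N, prime p -> (A : set G) `<=` N -> normal_in N B ->
     (forall x, csub_set N x -> ppow p A x) -> (N : set G) `<=` A) /\
  (forall Q, (A : set G) `<=` Q -> subnormal_in B Q -> ~ qs_section A Q).

Lemma qs_nsub A Q : qs_section A Q -> ~ (Q : set G) `<=` A.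
Proof. by move=> [nab _ _] QA; apply: nab => x y Qx Qy; apply/QA/csubR. Qed.

Lemma FD_section_refl B : FD_section B B.
Proof.
split=> [p N _ _ [] //|Q _ sQ /qs_nsub]; apply; exact: subnormal_in_sub.
Qed.

Lemma join_mod Q K B (X : topGroupType) (h : G -> X) (s : secmap K B h) x :
  normal_in K B -> (Q : set G) `<=` B -> csub_set (join Q K) x ->
  exists2 q, csub_set Q q & h x = h q /\ csub_set K (q^-1 * x).
Proof.
move=> nKB QB /(joinP nKB QB)[q [k [Qq Kk ->]]]; exists q => //.
have Bq := QB _ Qq; have Bk := nKB.1 _ Kk.
by rewrite mulKg (smM s) // (sm_ker s Bk).2 // mulg1.
Qed.

(** QK/K is a quotient of Q/A. If it is abelian, perfectness of Q/A forces Q into K; otherwise the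
    dichotomy for a normal M comes from the one for its intersection with Q. *)
Lemma qs_join A K B Q : (A : set G) `<=` K -> normal_in K B ->
  (A : set G) `<=` Q -> (Q : set G) `<=` B -> qs_section A Q ->
  (Q : set G) `<=` K \/ qs_section K (join Q K).
Proof.
move=> AK nKB AQ QB [nab perf dich].
have [QK|nQK] := pselect ((Q : set G) `<=` K); [by left|right].
have [X [h s]] := secmap_section nKB.
split.
- move=> ab; apply: nQK; apply: perf => // x y Qx Qy.
  by apply: ab; exact: join_l.
- move=> L KL cL; apply: join_min => //.
  apply: perf; first exact: subset_trans KL.
  by move=> x y Qx Qy; apply: cL; exact: join_l.
move=> M KM nM.
have nMQ : normal_in (csubI M Q) Q by apply: normalI nM _; exact: join_l.
have [|QM|cM] := dich _ _ nMQ.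
- by move=> a Aa; split; [exact/KM/AK|exact: AQ].
- by left; apply: join_min => // x /QM[].
right=> x y Mx jy.
have jx := nM.1 _ Mx.
have jB : (join Q K : set G) `<=` B by apply: join_min => //; exact: nKB.1.
have [q Qq [hq Kq]] := join_mod s nKB QB jx.
have [q' Qq' [hq' _]] := join_mod s nKB QB jy.
have Mq : csub_set M q.
  by have := csubM Mx (csubV (KM _ Kq)); rewrite invgM invgK mulVKg.
apply/(sm_comm s (jB _ jx) (jB _ jy)); rewrite hq hq'.
by apply/(sm_comm s (QB _ Qq) (QB _ Qq')); apply/AK/cM.
Qed.

(** NR/R is a quotient of a pro-p section, hence trivial. Normality is asked of NR rather than of N
    because in [FD_section_iso] N is normal only in a smaller subgroup. *)
Lemma FD_section_quot_pp p A R B N : prime p -> FD_section R B -> normal_in R B ->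
  (A : set G) `<=` R -> (N : set G) `<=` B -> normal_in (join N R) B ->
  (forall x, csub_set N x -> ppow p A x) -> (N : set G) `<=` R.
Proof.
move=> pp [fd _] nRB AR NB nNR pN.
apply: subset_trans (@join_l N R) _; apply: (fd p) => //; first exact: join_r.
have [X [h s]] := secmap_section nRB.
move=> x jx; have [n Nn [hn _]] := join_mod s nRB NB jx.
apply/(ppow_secmap p s (nNR.1 _ jx)); rewrite hn.
apply/(ppow_secmap p s (NB _ Nn)).
exact/(ppow_mono AR)/pN.
Qed.

Lemma FD_section_quot_qs A R B Q : FD_section R B -> normal_in R B ->
  (A : set G) `<=` R -> (A : set G) `<=` Q -> (Q : set G) `<=` B ->
  subnormal_in B (join Q R) -> qs_section A Q -> (Q : set G) `<=` R.
Proof.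
move=> [_ fd] nRB AR AQ QB sQR qQ.
have [//|qQR] := qs_join AR nRB AQ QB qQ.
by case: (fd _ _ sQR qQR); exact: join_r.
Qed.

Lemma join_normal_top N R B : normal_in N B -> normal_in R B -> normal_in (join N R) B.
Proof.
move=> nN nR; rewrite -[X in normal_in _ X](join_absorb nR.1).
exact: join_normal nR.
Qed.

Lemma subnormal_in_join_top Q R B : subnormal_in B Q -> normal_in R B -> subnormal_in B (join Q R).
Proof.
move=> sQ nR; rewrite -[X in subnormal_in X _](join_absorb nR.1).
exact: subnormal_in_join nR _ sQ.
Qed.

(** A normal pro-p section or a component has trivial image in each B/K, so it lies in every K. *)
Lemma FD_section_bigcap (P : set (csubgroup G)) B :
  (csub_bigcap P : set G) `<=` B ->
  (forall K, P K -> normal_in K B /\ FD_section K B) -> FD_section (csub_bigcap P) B.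
Proof.
move=> RB hP; have RK K : P K -> (csub_bigcap P : set G) `<=` K by move=> PK x; apply.
split=> [p N pp RN nN pN|Q RQ sQ qQ].
  move=> x Nx K PK; have [nK fK] := hP K PK.
  apply: (FD_section_quot_pp pp fK nK (RK K PK) nN.1 _ pN) => //.
  exact: join_normal_top.
case: (qs_nsub qQ) => x Qx K PK; have [nK fK] := hP K PK.
apply: (FD_section_quot_qs fK nK (RK K PK) RQ (subnormal_in_sub sQ) _ qQ) => //.
exact: subnormal_in_join_top.
Qed.

(** A normal pro-p section or a component of B/L has trivial image in B/R. It therefore lies in R,
    where it contradicts the degeneracy of R/L unless it is trivial. *)
Lemma FD_section_ext L R B : (L : set G) `<=` R -> normal_in R B ->
  FD_section L R -> FD_section R B -> FD_section L B.
Proof.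
move=> LR nR [fdp fdq] fRB; split=> [p N pp LN nN pN|Q LQ sQ qQ].
  have NR : (N : set G) `<=` R.
    by apply: (FD_section_quot_pp pp fRB nR LR nN.1 _ pN); exact: join_normal_top.
  by apply: (fdp p) => //; exact: normal_sub nN NR nR.1.
have QR : (Q : set G) `<=` R.
  apply: (FD_section_quot_qs fRB nR LR LQ (subnormal_in_sub sQ) _ qQ).
  exact: subnormal_in_join_top.
by apply: fdq qQ => //; exact: subnormal_in_restrict sQ nR.1 QR.
Qed.

(** Second isomorphism theorem: a normal pro-p section or a component of H modulo the intersection
    is carried to HR/R by joining with R. *)
Lemma FD_section_iso R H B : normal_in R B -> (H : set G) `<=` B ->
  FD_section R (join H R) -> FD_section (csubI H R) H.
Proof.
move=> nR HB fd.
have IR : (csubI H R : set G) `<=` R by move=> x [].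
have nRj : normal_in R (join H R).
  apply: (normal_sub nR); first exact: join_r.
  by apply: join_min => //; exact: nR.1.
have sub N : (N : set G) `<=` H -> (N : set G) `<=` join H R.
  by move=> NH; apply: subset_trans (@join_l H R).
split=> [p N pp RN nN pN|Q RQ sQ qQ].
  have NR := FD_section_quot_pp pp fd nRj IR (sub _ nN.1) (join_normal nN HB nR) pN.
  by move=> x Nx; split; [exact: nN.1|exact: NR].
have sQj := subnormal_in_join nR HB sQ.
have QR := FD_section_quot_qs fd nRj IR RQ (sub _ (subnormal_in_sub sQ)) sQj qQ.
by apply: (qs_nsub qQ) => x Qx; split; [exact: subnormal_in_sub sQ _ Qx|exact: QR].
Qed.

End Sections.
Arguments join_l {G} H K _ _.
Arguments join_r {G} H K _ _.

(** * Automorphisms *)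


Section Automorphisms.
Variable G : topGroupType.
Implicit Types A B H K L M N Q : csubgroup G.

Section Preimage.
Variable g : G -> G.
Hypothesis (gM : {morph g : x y / x * y}) (cg : continuous g).

Lemma morph1 : g 1 = 1.
Proof. by apply: (@mulgI _ (g 1)); rewrite -gM !mulg1. Qed.

Lemma morphV x : g x^-1 = (g x)^-1.
Proof. by apply: (@mulgI _ (g x)); rewrite -gM !mulgV morph1. Qed.

Lemma morphX x n : g (x ^+ n) = g x ^+ n.
Proof. by elim: n => [|n IH]; rewrite ?expg0 ?morph1 // !expgS gM IH. Qed.

Lemma morphJ x y : g (x ^ y) = g x ^ g y.
Proof. by rewrite !conjgE !gM morphV. Qed.

Lemma morphR x y : g [~ x, y] = [~ g x, g y].
Proof. by rewrite !commgEl gM morphV morphJ. Qed.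

(** Automorphisms act by preimages, for which closedness is immediate from continuity; images are
    preimages under the inverse. *)
Program Definition csub_pre H : csubgroup G :=
  @CSubgroup G (g @^-1` H) _ _ _ _.
Next Obligation. by move=> H; apply: closed_preimage => //; exact: csub_closed. Qed.
Next Obligation. by move=> H; rewrite /= morph1; exact: csub1. Qed.
Next Obligation. by move=> H x y Hx Hy; rewrite /= gM; exact: csubM. Qed.
Next Obligation. by move=> H x Hx; rewrite /= morphV; exact: csubV. Qed.

Lemma csub_pre_normal H L : normal_in H L -> normal_in (csub_pre H) (csub_pre L).
Proof.
move=> [HL nH]; split; first by move=> x /HL.
by move=> x h Lx Hh; rewrite /= morphJ; exact: nH.
Qed.

Lemma csub_pre_subn B H : subnormal_in B H -> subnormal_in (csub_pre B) (csub_pre H).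
Proof.
elim=> [|{}H L _ IH nH]; first exact: subnormal_in_refl.
by apply: subnormal_in_step IH _; exact: csub_pre_normal.
Qed.

End Preimage.

Variables f g : G -> G.
Hypothesis (fK : cancel f g) (gK : cancel g f).
Hypothesis (fM : {morph f : x y / x * y}) (cf : continuous f).
Hypothesis (gM : {morph g : x y / x * y}) (cg : continuous g).

Lemma ppow_pre p A x : ppow p A (g x) -> ppow p (csub_pre gM cg A) x.
Proof.
move=> px V oV AV; have [||k Vk] := px (f @^-1` V).
- by apply: open_comp oV => y _; exact: cf.
- by move=> a Aa /=; apply: AV; rewrite /= fK.
by exists k; rewrite -[x]gK -(morphX fM).
Qed.

Lemma csub_preK A : csub_pre gM cg (csub_pre fM cf A) = A.
Proof. by apply: csub_eqP => x; rewrite /= gK. Qed.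

Lemma csub_pre_le A L :
  (csub_pre gM cg A : set G) `<=` L -> (A : set G) `<=` csub_pre fM cf L.
Proof. by move=> AL a Aa /=; apply: AL; rewrite /= fK. Qed.

Lemma csub_pre_ge A L :
  (L : set G) `<=` csub_pre fM cf A -> (csub_pre gM cg L : set G) `<=` A.
Proof. by move=> LA x /LA; rewrite /= gK. Qed.

Lemma qs_pre A Q : qs_section A Q -> qs_section (csub_pre gM cg A) (csub_pre gM cg Q).
Proof.
move=> [nab perf dich]; split.
- move=> ab; apply: nab => x y Qx Qy.
  have := ab (f x) (f y); rewrite /= !fK => /(_ Qx Qy).
  by rewrite /= (morphR gM) !fK.
- move=> L AL cL; apply: csub_pre_ge; apply: perf; first exact: csub_pre_le.
  by move=> x y Qx Qy; rewrite /= (morphR fM); apply: cL; rewrite /= fK.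
move=> M AM nM; have [||QM|cM] := dich (csub_pre fM cf M).
- exact: csub_pre_le.
- split; first by move=> x /nM.1; rewrite /= fK.
  by move=> x h Qx Mh; rewrite /= (morphJ fM); apply: nM.2; rewrite //= fK.
- by left; exact: csub_pre_ge.
by right=> x y Mx Qy; rewrite /= (morphR gM); apply: cM; rewrite //= gK.
Qed.

End Automorphisms.

Section AutFD.
Variable G : topGroupType.
Variables f g : G -> G.
Hypothesis (fK : cancel f g) (gK : cancel g f).
Hypothesis (fM : {morph f : x y / x * y}) (cf : continuous f).
Hypothesis (gM : {morph g : x y / x * y}) (cg : continuous g).

Lemma FD_section_pre A B : FD_section A B -> FD_section (csub_pre gM cg A) (csub_pre gM cg B).
Proof.
have preK := csub_preK fK gM cg fM cf.
move=> [fdp fdq]; split=> [p N pp AN nN pN|Q AQ sQ qQ].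
  suff NA : (csub_pre fM cf N : set G) `<=` A.
    exact: (csub_pre_le gK gM cg NA).
  apply: (fdp p) => //.
  - exact: (csub_pre_le fK fM cf AN).
  - by have := csub_pre_normal fM cf nN; rewrite preK.
  - by move=> x /pN h; have := @ppow_pre G g f gK fK gM cg fM cf _ _ _ h; rewrite preK.
apply: (fdq (csub_pre fM cf Q)); first exact: (csub_pre_le fK fM cf AQ).
  by have := csub_pre_subn fM cf sQ; rewrite preK.
by have := qs_pre gK fK gM cg fM cf qQ; rewrite preK.
Qed.

End AutFD.

Section Conjugation.
Variables (G : topGroupType) (b : G).
Implicit Types A B N : csubgroup G.

Lemma conjg_morph : {morph (fun x : G => x ^ b) : x y / x * y}.
Proof. by move=> x y; exact: conjMg. Qed.

Lemma conjg_continuous : continuous (fun x : G => x ^ b).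
Proof.
have c1 := @cst_continuous G G b; have c2 := @cst_continuous G G b^-1.
have ci := @id_continuous G.
by apply: continuousM => //; exact: continuousM.
Qed.

(** Being a preimage, this is the conjugate of A by the inverse of b. *)
Definition csubJpre A := csub_pre conjg_morph conjg_continuous A.

Lemma csubJpre_id A B : normal_in A B -> csub_set B b -> csubJpre A = A.
Proof.
move=> [_ nA] Bb; apply: csub_eqP => x /=; last exact: nA.
by move=> /(nA b^-1); rewrite conjgK; apply; exact: csubV.
Qed.

End Conjugation.

Lemma FD_sectionJ (G : topGroupType) (b : G) A B : FD_section A B ->
  FD_section (csubJpre b A) (csubJpre b B).
Proof.
apply: (@FD_section_pre G (fun x => x ^ b^-1) (fun x => x ^ b)).
- by move=> x; rewrite conjgKV.
- by move=> x; rewrite conjgK.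
- exact: conjg_morph.
- exact: conjg_continuous.
Qed.

Lemma ppowJ (G : topGroupType) (b : G) p A x : ppow p A (x ^ b) -> ppow p (csubJpre b A) x.
Proof.
apply: (@ppow_pre G (fun x => x ^ b^-1) (fun x => x ^ b)).
- by move=> y; rewrite conjgKV.
- by move=> y; rewrite conjgK.
- exact: conjg_morph.
- exact: conjg_continuous.
Qed.

(** * Index and exponent of open normal subgroups *)

Section OpenSubgroups.
Variable G : topGroupType.

Lemma open_transversal (M : nsubgroup G) : compact [set: G] -> open (M : set G) ->
  exists s : seq G, forall x, exists2 t, t \in s & csub_set M (t^-1 * x).
Proof.
move=> cG oM.
(* In this filter a finite list eventually contains any given element; compactness then yields one
   list that meets all cosets of M. *)
pose F := filter_from [set: seq G] (fun s => [set s' : seq G | {subset s <= s'}]).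
have FF : Filter F.
  apply: filter_from_filter; first by exists [::].
  move=> s1 s2 _ _; exists (s1 ++ s2) => // s' sub.
  by split=> t ts; apply: sub; rewrite mem_cat ts ?orbT.
have : \near F, [set: G] `<=` (fun x => exists2 t, t \in F & csub_set M (t^-1 * x)).
  apply: (iffLR (compact_near_coveringP _) cG _ _
    (fun s x => exists2 t, t \in s & csub_set M (t^-1 * x))) => x _.
  have nM : nbhs (x^-1 * x) (M : set G).
    by rewrite mulVg; apply: open_nbhs_nbhs; split=> //; exact: csub1.
  exists ((fun y => x^-1 * y) @^-1` M, [set s' : seq G | {subset [:: x] <= s'}]).
    by split; [exact: translate_continuous nM|exists [:: x]].
  move=> [y s] /= [My sx]; exists x => //; apply: sx; exact: mem_head.
by move=> [s _ /(_ s)] h; exists s => x; apply: h.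
Qed.

(** With n representatives of the cosets, two of the n + 1 powers from 0 to n of x share a coset.
    Their difference of exponents is between 1 and n, so it divides n!. *)
Lemma open_exponent (M : nsubgroup G) : compact [set: G] -> open (M : set G) ->
  exists2 n, (0 < n)%N & forall x, csub_set M (x ^+ n).
Proof.
move=> cG /(open_transversal cG)[s sP]; exists (size s)`!; first exact: fact_gt0.
move=> x; have cP j : exists i : 'I_(size s), csub_set M ((tnth (in_tuple s) i)^-1 * x ^+ j).
  by have [t /(tnthP (in_tuple s))[i ->] Mt] := sP (x ^+ j); exists i.
have [d dP] : exists d : nat -> 'I_(size s),
    forall j, csub_set M ((tnth (in_tuple s) (d j))^-1 * x ^+ j).
  by have [d dP] := choice cP; exists d.
have /injectivePn[i [j ij dij]] : ~~ injectiveb (fun j : 'I_(size s).+1 => d j).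
  apply/negP => /injectiveP/leq_card; by rewrite !card_ord ltnn.
wlog ltij : i j ij dij / (i < j)%N.
  move=> H; have := ij; rewrite -val_eqE neq_ltn => /orP[ltij|ltij]; first exact: (H i j).
  by apply: (H j i) => //; rewrite eq_sym.
have Mij : csub_set M (x ^+ (j - i)).
  rewrite expgnFr ?(ltnW ltij) //.
  have e : x ^+ j * x ^- i = x ^- i * x ^+ j.
    by apply: commuteV; exact: commuteX2.
  rewrite e; have := csubM (csubV (dP i)) (dP j).
  by rewrite dij invgM invgK -!mulgA mulVKg.
have : (j - i %| (size s)`!)%N.
  apply: dvdn_fact; rewrite subn_gt0 ltij /=.
  by rewrite leq_subLR -ltnS (leq_trans (ltn_ord j)) // ltnS leq_addl.
by move=> /dvdnP[q ->]; rewrite mulnC expgnA; exact: csubX.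
Qed.

End OpenSubgroups.

(** * Components *)


Lemma commuteJ (X : groupType) (u b c : X) : commute (u ^ c^-1) b -> commute u (b ^ c).
Proof.
move=> e; have := congr1 (fun z => z ^ c) e.
by rewrite (conjMg (u ^ _)) (conjMg b) conjgKV.
Qed.

(* With alpha = [a, c] and beta = [b, c],
   [a, b]^c = [a alpha, b^c] = [a, b^c] = [a, b beta] = [a, b]. *)
Lemma commute_commg (X : groupType) (a b c : X) :
  commute [~ a, c] a -> commute [~ a, c] (b ^ c) ->
  commute [~ b, c] a -> commute [~ b, c] b -> commute [~ a, b] c.
Proof.
set al := [~ a, c]; set be := [~ b, c] => ca cbc da db.
have ea : a ^ c = a * al by rewrite /al commgEl mulVKg.
have eb : b ^ c = b * be by rewrite /be commgEl mulVKg.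
have RM (x y z : X) : commute y x -> commute y z -> [~ x * y, z] = [~ x, z].
  move=> yx yz; have cy : commute y [~ x, z].
    by apply: commuteM; [exact: commuteV|apply: commuteM; [exact: commuteV|exact: commuteM]].
  rewrite commgEl conjMg; have -> : y ^ z = y by apply/conjg_fixP/commgP.
  move: cy; rewrite commgEl; move: (x ^ z) => w cy.
  by rewrite invgM -!mulgA (mulgA x^-1) -cy mulKg.
have RMr (x y z : X) : commute y x -> commute y z -> [~ x, z * y] = [~ x, z].
  by move=> yx yz; apply: invg_inj; rewrite !invgR; exact: RM.
by apply/commgP/conjg_fixP; rewrite conjRg ea RM // eb RMr.
Qed.

Section Structure.
Variable G : topGroupType.
Hypothesis profG : profinite G.
Implicit Types A B C H K L M N Q R : csubgroup G.

(** L is the centralizer of T modulo C. Through a presentation of B/C the condition becomes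
    commutation, which gives the subgroup laws. T is a mere set, so that it can also be a single
    element. *)
Lemma cent_ex B C (T : set G) : normal_in C B -> T `<=` B ->
  exists L, forall g, csub_set L g <->
    csub_set B g /\ forall t, T t -> csub_set C [~ g, t].
Proof.
move=> nCB TB; have [X [h s]] := secmap_section profG nCB.
pose S := [set g | csub_set B g /\ forall t, T t -> csub_set C [~ g, t]].
have SE g : csub_set B g -> S g <-> forall t, T t -> commute (h g) (h t).
  move=> Bg; split=> [[_ Sg] t Tt|Sg].
    by apply/(sm_comm s Bg (TB _ Tt))/Sg.
  by split=> // t Tt; apply/(sm_comm s Bg (TB _ Tt))/Sg.
have cS : closed S.
  have -> : S = (B : set G) `&` \bigcap_(t in T) (fun g => [~ g, t]) @^-1` C.
    by apply/seteqP; split=> g [Bg Sg].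
  apply: closedI; first exact: csub_closed.
  apply: closed_bigI => t _; apply: closed_preimage; last exact: csub_closed.
  have -> : (fun g : G => [~ g, t]) = (fun g => g^-1 * g ^ t).
    by apply/funext => g; rewrite commgEl.
  have ci := @id_continuous G.
  apply: continuousM; first exact: continuousV.
  exact: conjg_continuous.
have SB g : S g -> csub_set B g by case.
have S1 : S 1.
  by apply/SE => [|t _]; [exact: csub1|rewrite (sm1 s)]; exact/commute_sym/commute1.
have SM x y : S x -> S y -> S (x * y).
  move=> Sx Sy; have Bx := SB _ Sx; have By := SB _ Sy.
  apply/SE => [|t Tt]; first exact: csubM.
  rewrite (smM s) //; apply/commute_sym/commuteM; apply/commute_sym.
    exact: (SE _ Bx).1.
  exact: (SE _ By).1.
have SV x : S x -> S x^-1.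
  move=> Sx; have Bx := SB _ Sx.
  apply/SE => [|t Tt]; first exact: csubV.
  by rewrite (smV s) //; apply/commute_sym/commuteV/commute_sym/(SE _ Bx).1.
by exists (CSubgroup cS S1 SM SV) => g; split.
Qed.

(** A normal subgroup contains a component or centralizes it. If N does not contain Q, its
    intersection with Q centralizes Q modulo C, and this is propagated up the subnormal chain from Q
    to B. *)
Lemma component_normal B C Q N : normal_in C B -> (C : set G) `<=` Q ->
  subnormal_in B Q -> qs_section C Q -> normal_in N B -> (C : set G) `<=` N ->
  (Q : set G) `<=` N \/
  (forall x y, csub_set N x -> csub_set Q y -> csub_set C [~ x, y]).
Proof.
move=> nC CQ sQ [nab perf dich] nN CN.
have QB := subnormal_in_sub sQ; have [X [h s]] := secmap_section profG nC.
have [|QN|cN] := dich _ _ (normalI nN QB).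
- by move=> c Cc; split; [exact: CN|exact: CQ].
- by left=> x /QN[].
right; suff : forall H, subnormal_in B H -> (Q : set G) `<=` H ->
    (forall x y, csub_set N x -> csub_set H x -> csub_set Q y -> csub_set C [~ x, y]) ->
    forall x y, csub_set N x -> csub_set Q y -> csub_set C [~ x, y].
  by move=> /(_ Q sQ); apply=> // x y Nx Qx; exact: cN.
move=> H; elim=> [|{}H L sL IH nH QH cH].
  by move=> _ cB x y Nx Qy; apply: cB => //; exact: nN.1.
have QL := subset_trans QH nH.1; have LB := subnormal_in_sub sL.
apply: IH => // n y Nn Ln Qy.
have Bn := nN.1 _ Nn.
have cH' x z : csub_set N x -> csub_set H x -> csub_set Q z -> commute (h x) (h z).
  move=> Nx Hx Qz.
  by apply/(sm_comm s (nN.1 _ Nx) (QB _ Qz)); exact: cH.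
have NHR z n' : csub_set N n' -> csub_set L n' -> csub_set Q z ->
    csub_set N [~ z, n'] /\ csub_set H [~ z, n'].
  move=> Nn' Ln' Qz; split.
    rewrite commgEr; apply: csubM => //; apply: nN.2; first exact: QB.
    exact: csubV.
  have Hz := QH _ Qz; rewrite commgEl; apply: csubM; first exact: csubV.
  exact: nH.2.
(* As Q/C is perfect, it is enough that the centralizer Z of n modulo C contains the commutators of
   Q. For a, b in Q the elements [a, n] and [b, n] lie in both N and H, hence centralize Q modulo C,
   and [commute_commg] applies. *)
have [|Z ZP] := @cent_ex B C [set n] nC; first by move=> _ ->.
have QZ : (Q : set G) `<=` Z.
  apply: perf.
    move=> c Cc; apply/ZP; split=> [|_ ->]; first exact: nC.1.
    by rewrite commgEl; apply: csubM; [exact: csubV|exact: nC.2].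
  move=> a b Qa Qb; have Ba := QB _ Qa; have Bb := QB _ Qb.
  apply/ZP; split=> [|_ ->]; first exact: csubR.
  apply/(sm_comm s) => //; first exact: csubR.
  rewrite (smR s) //.
  have [Nan Han] := NHR a n Nn Ln Qa.
  have [Nbn Hbn] := NHR b n Nn Ln Qb.
  have Bn1 := csubV Bn.
  have [Nan1 Han1] : csub_set N ([~ a, n] ^ n^-1) /\ csub_set H ([~ a, n] ^ n^-1).
    by split; [apply: nN.2|apply: nH.2 => //; exact: csubV].
  apply: commute_commg; rewrite -?(smR s) //; try exact: cH'.
  have := cH' _ _ Nan1 Han1 Qb; rewrite (smJ s) //; last by apply: csubR.
  rewrite (smV s) //; exact: commuteJ.
have /ZP[_ /(_ n erefl)] := QZ _ Qy.
by move=> /csubV; rewrite invgR.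
Qed.

(** Since Q lies in NC, the quotient of the two intersections with N is isomorphic to Q/C. *)
Lemma qs_cap B C N Q : normal_in C B -> (N : set G) `<=` B ->
  (Q : set G) `<=` join N C -> (C : set G) `<=` Q -> qs_section C Q ->
  qs_section (csubI C N) (csubI Q N).
Proof.
move=> nC NB QNC CQ [nab perf dich].
have [X [h s]] := secmap_section profG nC.
have QB : (Q : set G) `<=` B.
  by apply: subset_trans QNC _; apply: join_min => //; exact: nC.1.
have IB : (csubI Q N : set G) `<=` B by move=> x [/QB].
(* Dedekind's law: Q is the product of its intersection with N and of C. *)
have dec q : csub_set Q q -> exists2 n, csub_set (csubI Q N) n & h q = h n.
  move=> Qq; have [n Nn [hn Cn]] := join_mod profG s nC NB (QNC _ Qq).
  exists n => //; split=> //.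
  by have := csubM Qq (csubV (CQ _ Cn)); rewrite invgM invgK mulVKg.
split.
- move=> ab; apply: nab => x y Qx Qy.
  have [x' Ix hx] := dec _ Qx; have [y' Iy hy] := dec _ Qy.
  apply/(sm_comm s (QB _ Qx) (QB _ Qy)); rewrite hx hy.
  by apply/(sm_comm s (IB _ Ix) (IB _ Iy)); case: (ab _ _ Ix Iy).
- move=> L IL cL; pose L1 := csubI L (csubI Q N).
  have L1B : (L1 : set G) `<=` B by move=> x [_ /IB].
  have : (Q : set G) `<=` join L1 C.
    apply: perf; first exact: join_r.
    move=> x y Qx Qy.
    have [x' Ix hx] := dec _ Qx; have [y' Iy hy] := dec _ Qy.
    have jxy : csub_set L1 [~ x', y'] by split; [exact: cL|exact: csubR].
    rewrite -(mulVKg [~ x', y'] [~ x, y]); apply: csubM; first exact: join_l.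
    apply: join_r; apply/(sm_eq s); [exact/L1B|exact/QB/csubR|].
    have Bx := QB _ Qx; have By := QB _ Qy.
    by rewrite !(smR s) ?hx ?hy //; exact: IB.
  move=> QL q [Qq Nq].
  have [l [c [[Ll [Ql Nl]] Cc eq]]] := joinP profG nC L1B (QL _ Qq).
  rewrite eq; apply: csubM => //; apply: IL; split=> //.
  by have := csubM (csubV Nl) Nq; rewrite eq mulKg.
move=> M IM nM.
have MB : (M : set G) `<=` B by apply: subset_trans IB; exact: nM.1.
have nMC : normal_in (join M C) Q.
  split; first by apply: join_min => // x /nM.1[].
  move=> x m Qx /(joinP profG nC MB)[m' [c [Mm' Cc ->]]].
  have [n In hn] := dec _ Qx; have Bn := IB _ In.
  have Cnx : csub_set C (n^-1 * x) by apply/(sm_eq s) => //; exact: QB.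
  rewrite -(mulVKg n x) conjgM; apply: csubJ; first exact: join_r.
  rewrite conjMg; apply: csubM; first by apply/join_l/nM.2.
  by apply/join_r/nC.2.
have [|QM|cM] := dich _ _ nMC; first exact: join_r.
- left=> q [Qq Nq]; have [m [c [Mm Cc eq]]] := joinP profG nC MB (QM _ Qq).
  rewrite eq; apply: csubM => //; apply: IM; split=> //.
  have [_ Nm] := nM.1 _ Mm.
  by have := csubM (csubV Nm) Nq; rewrite eq mulKg.
right=> x y Mx [Qy Ny]; have [Qx Nx] := nM.1 _ Mx.
by split; [apply: cM => //; exact: join_l|exact: csubR].
Qed.
End Structure.

(** * Inheritance of Fitting-degeneracy *)


Section Inheritance.
Variable G : topGroupType.
Hypothesis profG : profinite G.
Implicit Types A B C H K L M N Q R Z : csubgroup G.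

(** The product of two normal pro-p subgroups is pro-p, shown elementwise modulo an open normal
    M. *)
Lemma ppow_join p A H N1 N2 x y : normal_in A H ->
  (A : set G) `<=` N1 -> normal_in N1 H -> (A : set G) `<=` N2 -> normal_in N2 H ->
  (forall x, csub_set N1 x -> ppow p A x) ->
  (forall x, csub_set N2 x -> ppow p A x) ->
  csub_set N1 x -> csub_set N2 y -> ppow p A (x * y).
Proof.
move=> nA AN1 nN1 AN2 nN2 p1 p2 N1x N2y.
have [X [h s]] := secmap_section profG nN1.
apply/(ppowP profG) => M oM.
have [Y [g t]] := secmap_section profG (nsub_normalT M).
have [k [a Aa Ma]] := (ppowP profG p A y).1 (p2 _ N2y) M oM.
set n := (p ^ k)%N in Ma.
have Hx := nN1.1 _ N1x; have Hy := nN2.1 _ N2y.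
(* Modulo N1 the powers of x y and y agree, so u lies in N1; modulo M the last two factors cancel,
   so u agrees with the n-th power of x y. A further p-power thus brings it into AM. *)
pose u := (x * y) ^+ n * y ^- n * a.
have Hxyn : csub_set H ((x * y) ^+ n) by apply/csubX/csubM.
have Hyn : csub_set H (y ^+ n) by exact: csubX.
have N1u : csub_set N1 u.
  apply: csubM; last exact: AN1.
  apply/(sm_ker s); first by apply: csubM => //; exact: csubV.
  rewrite (smM s) ?(smV s) //; last exact: csubV.
  rewrite !(smX s) //; last exact: csubM.
  by rewrite (smM s) // (sm_ker s Hx).2 // mul1g mulgV.
have gu : g u = g ((x * y) ^+ n).
  have I1 z : csub_set csubT z by [].
  rewrite /u !(smM t) //.
  have -> : g a = g (y ^+ n) by apply/(sm_eq t).
  by rewrite (smV t) // mulgVK.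
have [l [b Ab Mb]] := (ppowP profG p A u).1 (p1 _ N1u) M oM.
exists (k + l)%N, b => //; rewrite expnD expgnA.
apply/(sm_eq t) => //; rewrite (smX t) // -gu -(smX t) //.
by apply/(sm_eq t).
Qed.

(** Components of H are components of B. For pro-p subgroups, those normal in H need not be normal
    in B, but the closed subgroup generated by all of them is. *)
Lemma FD_section_normal A H B : normal_in A B -> (A : set G) `<=` H -> normal_in H B ->
  FD_section A B -> FD_section A H.
Proof.
move=> nA AH nH [fdp fdq]; split; last first.
  move=> Q AQ sQ; apply: fdq => //.
  by apply: subnormal_in_trans sQ; exact: subnormal_in_normal.
move=> p N pp AN nN pN.
have nAH : normal_in A H := normal_sub nA AH nH.1.
pose good N1 := [/\ (A : set G) `<=` N1, normal_in N1 H &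
  forall x, csub_set N1 x -> ppow p A x].
have goodA : good A by split=> // x Ax; exact: ppow_mem.
pose S := [set x | exists2 N1, good N1 & csub_set N1 x].
have S1 : S 1 by exists A => //; exact: csub1.
have SM x y : S x -> S y -> S (x * y).
  move=> [N1 [A1 n1 p1] N1x] [N2 [A2 n2 p2] N2y].
  exists (join N1 N2); last by apply: csubM; [exact: join_l|exact: join_r].
  split; first exact: subset_trans (join_l N1 N2).
    exact: join_normal_top.
  move=> z /(joinP profG n2 n1.1)[u [v [N1u N2v ->]]].
  exact: (ppow_join nAH A1 n1 A2 n2 p1 p2).
have SV x : S x -> S x^-1 by move=> [N1 g1 N1x]; exists N1 => //; exact: csubV.
have SJ b x : csub_set B b -> S x -> S (x ^ b).
  move=> Bb [N1 [A1 n1 p1] N1x]; have BV := csubV Bb.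
  (* This is the conjugate of N1 by b. *)
  exists (csubJpre b^-1 N1); last by rewrite /= conjgK.
  have eA := csubJpre_id nA BV; have eH := csubJpre_id nH BV.
  split.
  - by move=> a; rewrite -{1}eA => /A1.
  - by rewrite -eH; exact: csub_pre_normal.
  - by move=> z /p1/ppowJ; rewrite eA.
have SH : S `<=` H by move=> x [N1 [_ n1 _] N1x]; exact: n1.1.
have nO : normal_in (gen S) B.
  split; first by apply: subset_trans nH.1; exact: gen_min.
  move=> b x Bb; apply: (gen_min (H := csubJpre b (gen S))) x => x Sx.
  by apply: gen_sub; exact: SJ.
have pO x : csub_set (gen S) x -> ppow p A x.
  move=> Ox; apply/(ppowP profG) => M oM.
  have [Y [g t]] := secmap_section profG (nsub_normalT M).
  (* W is SM, an open and hence closed subgroup, so it contains [gen S]: modulo M each element of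
     [gen S] agrees with one of S, which has p-power order. *)
  pose W := [set z | exists2 a, S a & csub_set M (a^-1 * z)].
  have WP z : W z <-> exists2 a, S a & g a = g z.
    by split=> -[a Sa ga]; exists a => //; apply/(sm_eq t).
  have W1 : W 1 by apply/WP; exists 1.
  have WM u v : W u -> W v -> W (u * v).
    move=> /WP[a Sa ga] /WP[b Sb gb]; apply/WP; exists (a * b); first exact: SM.
    by rewrite !(smM t) // ga gb.
  have WV u : W u -> W u^-1.
    move=> /WP[a Sa ga]; apply/WP; exists a^-1; first exact: SV.
    by rewrite !(smV t) // ga.
  have oW : open W by exact: open_translates.
  have cW := open_subgroup_closed oW WM WV W1.
  have : (gen S : set G) `<=` CSubgroup cW W1 WM WV.
    by apply: gen_min => z Sz; apply/WP; exists z.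
  move=> /(_ _ Ox)/WP[a [N1 [_ _ p1] N1a] ga].
  have [k [b Ab Mb]] := (ppowP profG p A a).1 (p1 _ N1a) M oM.
  exists k, b => //; apply/(sm_eq t) => //.
  by rewrite (smX t) // -ga -(smX t) //; apply/(sm_eq t).
have AO : (A : set G) `<=` gen S by move=> a Aa; apply: gen_sub; exists A.
by move=> x Nx; apply: (fdp p _ pp AO nO pO); apply: gen_sub; exists N.
Qed.

Lemma FD_section_subnormal A H B : normal_in A B -> (A : set G) `<=` H -> subnormal_in B H ->
  FD_section A B -> FD_section A H.
Proof.
move=> nA AH sH fd; elim: sH AH => [|{}H L sL IH nH AH]; first by [].
have AL := subset_trans AH nH.1.
apply: (FD_section_normal _ AH nH); last exact: IH.
exact: normal_sub nA AL (subnormal_in_sub sL).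
Qed.

Lemma closed_powers Z A m :
  closed [set y | exists u a, [/\ csub_set Z u, csub_set A a & y = u ^+ m * a]].
Proof.
have cX : continuous (fun u : G => u ^+ m).
  elim: m => [|m IH].
    have -> : (fun u : G => u ^+ 0) = (fun _ => 1) by apply/funext => u; rewrite expg0.
    exact: cst_continuous.
  have -> : (fun u : G => u ^+ m.+1) = (fun u => u * u ^+ m).
    by apply/funext => u; rewrite expgS.
  by apply: continuousM => //; exact: id_continuous.
have cI : closed ((fun u : G => u ^+ m) @` Z).
  apply: compact_closed; first exact: topgroup_hausdorff.
  apply: continuous_compact; first by move=> x; exact/continuous_subspaceT.
  exact/closed_compact/csub_closed.
have := closed_mul profG cI (csub_closed (c := A)).
congr closed; apply/seteqP; split=> [_ [_ [a [[u Zu <-] Aa ->]]]|_ [u [a [Zu Aa ->]]]].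
  by exists u, a.
by exists (u ^+ m), a; split=> //; exists u.
Qed.

Lemma coprime_inverse p m : prime p -> coprime p m -> exists m' q, (m * m' = 1 + p * q)%N.
Proof.
move=> pp cpm.
have m0 : (0 < m)%N.
  by case: m cpm => //; rewrite /coprime gcdn0 => /eqP p1; rewrite p1 in pp.
have [km kn e _] := egcdnP p m0.
exists km, kn; rewrite mulnC e addnC [gcdn m p]gcdnC (eqP cpm) mulnC.
by [].
Qed.

(* For a central section Z/A, the Sylow p-subgroup of Z/A is the intersection of
   the groups of m-th powers with m prime to p. *)
Lemma FD_section_central A Z B : normal_in A B -> (A : set G) `<=` Z -> (Z : set G) `<=` B ->
  (forall z b, csub_set Z z -> csub_set B b -> csub_set A [~ z, b]) ->
  FD_section A B -> (Z : set G) `<=` A.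
Proof.
move=> nA AZ ZB cZ [fdp _] z Zz; apply: contrapT => nAz.
have AB : (A : set G) `<=` B := subset_trans AZ ZB.
have [X [h s]] := secmap_section profG nA.
have ch u v : csub_set Z u -> csub_set B v -> commute (h u) (h v).
  by move=> Zu Bv; apply/(sm_comm s (ZB _ Zu) Bv)/cZ.
(* As A is closed, some open normal M leaves z outside AM. *)
have [M oM zM] : exists2 M : nsubgroup G, open (M : set G) &
    forall a, csub_set A a -> ~ csub_set M (a^-1 * z).
  have c : continuous (fun u : G => z * u^-1).
    by apply: continuousM; [exact: cst_continuous|apply: continuousV; exact: id_continuous].
  have nU : nbhs (1 : G) ((fun u => z * u^-1) @^-1` (~` (A : set G))).
    apply: c; apply: open_nbhs_nbhs; split; first exact/closed_openC/csub_closed.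
    by rewrite /= invg1 mulg1.
  have [M oM MU] := openN_basis profG nU; exists M => // a Aa /MU /=.
  by rewrite invgM invgK mulVKg; apply.
have nM := nsub_normalT M.
have AT : (A : set G) `<=` csubT by [].
pose AM := join A M.
have AMP x : csub_set AM x -> exists2 a, csub_set A a & csub_set M (a^-1 * x).
  move=> /(joinP profG nM AT)[a [m [Aa Mm ->]]]; exists a; by rewrite ?mulKg.
have nAMz : ~ csub_set AM z by move=> /AMP[a Aa Mz]; exact: (zM a).
have [n n0 nP] := open_exponent profG.1 oM.
have exn : exists n, (0 < n)%N && `[< csub_set AM (z ^+ n) >].
  by exists n; rewrite n0; apply/asboolP/join_r/nP.
(* j is the order of z modulo AM, and p a prime divisor of it; then x, a power of z, has order p
   modulo AM. *)
case: (ex_minnP exn) => j /andP[j0 /asboolP AMj] jmin.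
have j1 : (1 < j)%N.
  by rewrite ltn_neqAle j0 andbT; apply/eqP => j1; apply: nAMz; rewrite -[z]expg1 j1.
have pp := pdiv_prime j1; set p := pdiv j in pp.
pose x := z ^+ (j %/ p)%N.
have Zx : csub_set Z x by exact: csubX.
have nAMx : ~ csub_set AM x.
  move=> AMx; have /jmin : (0 < j %/ p)%N && `[< csub_set AM (z ^+ (j %/ p)%N) >].
    apply/andP; split; last exact/asboolP.
    by rewrite divn_gt0 ?pdiv_gt0 // dvdn_leq // pdiv_dvd.
  by rewrite leqNgt ltn_Pdiv // prime_gt1.
have AMxp : csub_set AM (x ^+ p) by rewrite -expgnA divnK // pdiv_dvd.
pose D m := [set y | exists u a, [/\ csub_set Z u, csub_set A a & y = u ^+ m * a]].
have DP m y : D m y <-> csub_set Z y /\ exists2 u, csub_set Z u & h y = h u ^+ m.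
  split=> [[u [a [Zu Aa ->]]]|[Zy [u Zu hy]]].
    have ZX : csub_set Z (u ^+ m) by exact: csubX.
    split; first by apply: csubM => //; exact: AZ.
    exists u => //; rewrite (smM s) ?(smX s) //; [|exact: ZB|exact: ZB|exact: AB].
    by rewrite (sm_ker s (AB _ Aa)).2 // mulg1.
  have ZX : csub_set Z (u ^+ m) by exact: csubX.
  exists u, ((u ^+ m)^-1 * y); split=> //; last by rewrite mulVKg.
  by apply/(sm_eq s); [exact: ZB|exact: ZB|rewrite (smX s) //; exact: ZB].
pose S := \bigcap_(m in [set m | coprime p m]) D m.
have SZ y : S y -> csub_set Z y.
  by move=> /(_ 1%N); rewrite /= coprimen1 => /(_ isT)/DP[].
have cS : closed S by apply: closed_bigI => m _; exact: closed_powers.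
have AS : (A : set G) `<=` S.
  by move=> a Aa m _; exists 1, a; split; rewrite ?expg1n ?mul1g //; exact: csub1.
have SM y y' : S y -> S y' -> S (y * y').
  move=> Sy Sy' m cm; have /DP[Zy [u Zu hy]] := Sy m cm.
  have /DP[Zy' [u' Zu' hy']] := Sy' m cm.
  apply/DP; split; first exact: csubM.
  exists (u * u'); first exact: csubM.
  rewrite !(smM s) ?hy ?hy' ?expgMn //; try exact: ZB.
  by apply: ch => //; exact: ZB.
have SV y : S y -> S y^-1.
  move=> Sy m cm; have /DP[Zy [u Zu hy]] := Sy m cm.
  apply/DP; split; first exact: csubV.
  exists u^-1; first exact: csubV.
  by rewrite !(smV s) ?hy ?expVgn //; exact: ZB.
pose P := CSubgroup cS (AS _ (csub1 A)) SM SV.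
have nP' : normal_in P B.
  split=> [y /SZ/ZB //|b y Bb Sy m cm]; have Zy := SZ _ Sy.
  have hyb : h (y ^ b) = h y.
    by rewrite (smJ s) //; [apply/conjg_fixP/eqP/eqP/commgP/ch|exact: ZB].
  have /DP[_ [u Zu hy]] := Sy m cm.
  apply/DP; split; last by exists u; rewrite // hyb.
  rewrite -(mulVKg y (y ^ b)); apply: csubM => //; apply: AZ.
  by rewrite -commgEl; exact: cZ.
(* P is pro-p modulo A: if the exponent modulo M' is m times a power of p, with m prime to p, write
   y as an m-th power u ^+ m modulo A; that power of p then sends y into AM'. *)
have PA : (P : set G) `<=` A.
  apply: (fdp p) => // y Sy; apply/(ppowP profG) => M' oM'.
  have [n' n'0 n'P] := open_exponent profG.1 oM'.
  have [m cpm en] := pfactor_coprime pp n'0.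
  have [u [a [Zu Aa ey]]] := Sy _ cpm.
  exists (logn p n').
  have Bu := ZB _ Zu; have By := ZB _ (SZ _ Sy).
  have e : h (y ^+ (p ^ logn p n')%N) = h (u ^+ n').
    rewrite (smX s) // ey (smM s) ?(sm_ker s (AB _ Aa)).2 ?mulg1 //; last 2 first.
    - exact: csubX.
    - exact: AB.
    by rewrite (smX s) // -expgnA -en (smX s).
  exists (y ^+ (p ^ logn p n')%N * (u ^+ n')^-1).
    apply/(sm_ker s); first by apply: csubM; [exact: csubX|exact/csubV/csubX].
    by rewrite (smM s) ?(smV s) ?e ?mulgV //; [exact: csubX|exact: csubX|exact/csubV/csubX].
  by rewrite invgM invgK -mulgA mulVg mulg1.
have cxAM : closed [set y | csub_set AM (x^-1 * y)].
  by apply: closed_preimage (csub_closed (c := AM)); exact: translate_continuous.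
(* The coset x AM meets every D m, because m m' = 1 + p q puts x ^+ (m m') in it. By compactness it
   meets P, which lies in A, so x would be in AM. *)
have [||||y [AMy /PA Ay]] := @compact_directed G nat [set m | coprime p m] D _
    (closed_compact profG cxAM).
- by exists 1%N; rewrite /= coprimen1.
- by move=> m _; exact: closed_powers.
- move=> m1 m2 /= c1 c2; exists (m1 * m2)%N; first by rewrite /= coprimeMr c1.
  move=> y /DP[Zy [u Zu hy]]; have Bu := ZB _ Zu.
  split; apply/DP; split=> //; [exists (u ^+ m2)|exists (u ^+ m1)]; try exact: csubX.
    by rewrite hy (smX s) // -expgnA mulnC.
  by rewrite hy (smX s) // -expgnA.
- move=> m cpm; have [m' [q e]] := coprime_inverse pp cpm.
  exists (x ^+ (m * m')%N); split.
    change (csub_set AM (x^-1 * x ^+ (m * m')%N)).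
    by rewrite e expgnDr expg1 mulKg expgnA; exact: csubX.
  by exists (x ^+ m'), 1; split; [exact: csubX|exact: csub1|rewrite mulg1 mulnC expgnA].
apply: nAMx; have := csubM (join_l A M _ Ay) (csubV AMy).
by rewrite invgM invgK mulVKg.
Qed.

End Inheritance.

(** * Residuals *)


Lemma ltn_sub_count (T : eqType) (a1 a2 : pred T) (s : seq T) t :
  subpred a1 a2 -> t \in s -> a2 t -> ~~ a1 t -> (count a1 s < count a2 s)%N.
Proof.
move=> sub + a2t na1t; elim: s => //= u s IH; rewrite inE => /orP[/eqP <-|/IH lt].
  by rewrite a2t (negbTE na1t) add0n add1n ltnS sub_count.
by have := sub u; case: (a1 u) => [->//|_]; rewrite ?ltn_add2l // ltn_addl.
Qed.

Section Residual.
Variable G : topGroupType.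
Hypothesis profG : profinite G.
Implicit Types A B C D H K L M N Q R T : csubgroup G.

(* O^[FD](B). *)
Definition residual B : csubgroup G :=
  csub_bigcap [set K | normal_in K B /\ FD_section K B].

(** Fitting-regularity of B in contrapositive form: each Fitting-degenerate quotient is trivial. *)
Definition FR_subgroup B : Prop :=
  forall K, normal_in K B -> FD_section K B -> (B : set G) `<=` K.

Lemma residual_min K B : normal_in K B -> FD_section K B -> (residual B : set G) `<=` K.
Proof. by move=> nK fK x; apply. Qed.

Lemma residual_normal B : normal_in (residual B) B.
Proof.
split; first by apply: residual_min; [exact: normal_refl|exact: FD_section_refl].
by move=> x h Bx Rh K [nK fK]; apply: nK.2 => //; exact: Rh.
Qed.

Lemma FD_section_residual B : FD_section (residual B) B.
Proof. by apply: FD_section_bigcap => //; exact: (residual_normal B).1. Qed.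

(** An automorphism preserving B permutes the kernels of the Fitting-degenerate quotients of B. It
    serves for conjugations in [residual_char] and for the characteristic clause of the theorem. *)
Lemma residual_pre (f g : G -> G) (fM : {morph f : x y / x * y}) (cf : continuous f)
    (gM : {morph g : x y / x * y}) (cg : continuous g) B :
  cancel f g -> cancel g f -> csub_pre gM cg B = B ->
  forall x, csub_set (residual B) x -> csub_set (residual B) (g x).
Proof.
move=> fK gK eB x Rx K [nK fdK]; apply: (Rx (csub_pre gM cg K)); split.
  by rewrite -[X in normal_in _ X]eB; exact: csub_pre_normal.
by rewrite -[X in FD_section _ X]eB; exact: (FD_section_pre fK gK fM cf).
Qed.

Lemma residual_char N B : normal_in N B -> normal_in (residual N) B.
Proof.
move=> nN; split; first exact: subset_trans (residual_normal N).1 nN.1.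
move=> b x Bb.
apply: (@residual_pre (fun y => y ^ b^-1) (fun y => y ^ b) (@conjg_morph _ _)
  (@conjg_continuous _ _) (@conjg_morph _ _) (@conjg_continuous _ _)).
- by move=> y; rewrite conjgKV.
- by move=> y; rewrite conjgK.
- exact: csubJpre_id nN Bb.
Qed.

Lemma FR_subgroup_residual B : FR_subgroup (residual B).
Proof.
move=> K nK fK; set R := residual B in nK fK *; have nR := residual_normal B.
(* The intersection of the conjugates of K under B is normal in B and has Fitting-degenerate
   quotients R/core and then B/core, so it contains R. *)
pose P := [set L | exists2 b, csub_set B b & L = csubJpre b K].
have LR : (csub_bigcap P : set G) `<=` K.
  move=> x; apply; exists 1; first exact: csub1.
  by apply: csub_eqP => y; rewrite /= conjg1.
have hP L : P L -> normal_in L R /\ FD_section L R.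
  move=> [b Bb ->]; rewrite -[X in normal_in _ X](csubJpre_id nR Bb).
  split; first exact: csub_pre_normal.
  by rewrite -[X in FD_section _ X](csubJpre_id nR Bb); exact: FD_sectionJ.
have LR' : (csub_bigcap P : set G) `<=` R := subset_trans LR nK.1.
have fL : FD_section (csub_bigcap P) R by exact: FD_section_bigcap.
apply: subset_trans LR; apply: residual_min.
  2: exact: FD_section_ext LR' nR fL (FD_section_residual B).
split; first exact: subset_trans nR.1.
move=> b x Bb Lx _ [c Bc ->] /=; rewrite -conjgM.
by apply: (Lx (csubJpre (b * c) K)); exists (b * c) => //; exact: csubM.
Qed.

(* Modulo S = O^[FD](N), the centralizer C of N meets N trivially and B/C is
   Fitting-degenerate, so B = C. *)
Lemma FR_subgroup_normal N B : normal_in N B -> FR_subgroup B -> FR_subgroup N.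
Proof.
move=> nN frB; set S := residual N.
suff NS : (N : set G) `<=` S by move=> K nK fK; exact: subset_trans NS (residual_min nK fK).
have nSN : normal_in S N := residual_normal N.
have nS : normal_in S B := residual_char nN.
have [C CP] := cent_ex profG nS nN.1.
have CB : (C : set G) `<=` B by move=> x /CP[].
have SC : (S : set G) `<=` C.
  move=> x Sx; apply/CP; split; first exact: nS.1.
  move=> t Nt; rewrite commgEl; apply: csubM; first exact: csubV.
  by apply: nS.2 => //; exact: nN.1.
have nC : normal_in C B.
  split=> // b c Bb Cc; have Bc := CB _ Cc; apply/CP; split; first exact: csubJ.
  move=> t Nt; have /CP[_ /(_ (t ^ b^-1)) cct] := Cc.
  rewrite -[t](conjgKV b) -conjRg; apply: nS.2 => //; apply: cct.
  by apply: nN.2 => //; exact: csubV.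
(* Modulo S this intersection is central in N, and N/S is Fitting-degenerate. *)
have CN : (csubI C N : set G) `<=` S.
  have nSI : (S : set G) `<=` csubI C N.
    by move=> x Sx; split; [exact: SC|exact: nSN.1].
  apply: (FD_section_central profG nSN nSI _ _ (FD_section_residual N)); first by move=> x [].
  by move=> x t [/CP[_ Cx] _] Nt; exact: Cx.
have fdS : FD_section S N := FD_section_residual N.
suff fdC : FD_section C B.
  by move=> x Nx; apply: CN; split=> //; apply: frB nC fdC _ (nN.1 _ Nx).
(* If M is normal and pro-p modulo C, its intersection with N is pro-p modulo S, hence inside S. It
   contains [M, N], so M centralizes N modulo S. *)
split=> [p M pp CM nM pM|Q CQ sQ qQ].
  have nI : normal_in (csubI M N) N by exact: normalI nM nN.1.
  have MNS : (csubI M N : set G) `<=` S.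
    apply: (fdS.1 p) => //; first by move=> x Sx; split; [exact/CM/SC|exact: nSN.1].
    move=> x [Mx Nx]; apply: ppow_mono CN _.
    by apply: ppow_capl => //; exact: pM.
  move=> m Mm; apply/CP; split; first exact: nM.1.
  move=> t Nt; apply: MNS; split.
    rewrite commgEl; apply: csubM; first exact: csubV.
    by apply: nM.2 => //; exact: nN.1.
  rewrite commgEr; apply: csubM => //.
  by apply: nN.2; [exact: nM.1|exact: csubV].
have CNC : (C : set G) `<=` join N C := join_r N C.
have nNC : normal_in (join N C) B := join_normal_top profG nN nC.
(* If Q lies in NC, its intersection with N is a component of N modulo S, which is impossible.
   Otherwise [N, Q] lies in both C and N, hence in S, and Q would be inside C. *)
have [QNC|cQ] := component_normal profG nC CQ sQ qQ nNC CNC.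
  have qI := qs_cap profG nC nN.1 QNC CQ qQ.
  have eS : csubI C N = S.
    by apply: csub_eqP => // x Sx; split; [exact: SC|exact: nSN.1].
  rewrite eS in qI; apply: (fdS.2 (csubI Q N)) => //.
    by move=> x Sx; split; [exact/CQ/SC|exact: nSN.1].
  exact: subnormal_in_cap nN.1.
apply: (qs_nsub qQ) => q Qq; apply/CP; split; first exact: subnormal_in_sub sQ _ Qq.
move=> t Nt; apply: CN; split.
  by rewrite -invgR; apply: csubV; apply: cQ => //; exact: join_l.
rewrite commgEr; apply: csubM => //.
by apply: nN.2; [exact: subnormal_in_sub sQ _ Qq|exact: csubV].
Qed.

Lemma FR_subgroup_subnormal N B : subnormal_in B N -> FR_subgroup B -> FR_subgroup N.
Proof. by move=> sN frB; elim: sN => // {}N L _ frL nN; exact: FR_subgroup_normal frL. Qed.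

(** If H is Fitting-regular, then HR/R, for R the residual of B, is Fitting-degenerate as a
    subnormal subgroup of B/R. It is isomorphic to a quotient of H, so that quotient is trivial.
    Conversely, a subnormal H inside R inherits regularity from R. *)
Lemma FR_subgroup_subnormalP H B : subnormal_in B H ->
  FR_subgroup H <-> (H : set G) `<=` residual B.
Proof.
move=> sH; have nR := residual_normal B; split=> [frH|HR]; last first.
  apply: (FR_subgroup_subnormal _ (@FR_subgroup_residual B)).
  exact: subnormal_in_restrict sH nR.1 HR.
have sJ : subnormal_in B (join H (residual B)) by exact: subnormal_in_join_top.
have fdJ := FD_section_subnormal profG nR (join_r H (residual B)) sJ (FD_section_residual B).
have HB := subnormal_in_sub sH.
have fdI := FD_section_iso profG nR HB fdJ.
have nI : normal_in (csubI H (residual B)) H.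
  split; first by move=> x [].
  by move=> x h Hx [Hh Rh]; split; [exact: csubJ|apply: nR.2 => //; exact: HB].
by move=> x /(frH _ nI fdI)[].
Qed.

(* Induction on the number of cosets of M met by X. *)
Lemma FD_section_finite K C (M : nsubgroup G) : open (M : set G) -> normal_in K C ->
  FD_section K C -> (forall x, csub_set C x -> csub_set M x -> csub_set K x) ->
  (C : set G) `<=` K.
Proof.
move=> oM nK fd CMK; have [s sP] := open_transversal profG.1 oM.
pose mu X := count (fun t => `[< exists2 x, csub_set X x & csub_set M (x^-1 * t) >]) s.
suff : forall n X, (mu X < n)%N -> (K : set G) `<=` X -> subnormal_in C X ->
    (X : set G) `<=` K.
  by move=> /(_ _ C (ltnSn _) nK.1); apply; exact: subnormal_in_refl.
elim=> // n IH X muX KX sX.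
have XC := subnormal_in_sub sX.
have nKX : normal_in K X := normal_sub nK KX XC.
have fdX : FD_section K X by exact: (FD_section_subnormal profG nK).
(* A proper normal Y above K meets fewer cosets of M: if y in Y shares a coset with x, the quotient
   of the two lies in K, hence x in Y. So the induction hypothesis puts Y inside K. *)
have small (Y : csubgroup G) : (K : set G) `<=` Y -> normal_in Y X ->
    (X : set G) `<=` Y \/ (Y : set G) `<=` K.
  move=> KY nY; have [|nXY] := pselect ((X : set G) `<=` Y); [by left|right].
  apply: IH => //; last exact: subnormal_in_step sX nY.
  have [x Xx nYx] : exists2 x, csub_set X x & ~ csub_set Y x.
    apply: contrapT => no; apply: nXY => x Xx; apply: contrapT => nYx.
    by apply: no; exists x.
  rewrite -ltnS; apply: leq_trans muX; rewrite ltnS.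
  have sub : subpred
      (fun t => `[< exists2 x, csub_set Y x & csub_set M (x^-1 * t) >])
      (fun t => `[< exists2 x, csub_set X x & csub_set M (x^-1 * t) >]).
    by move=> t /asboolP[y Yy My]; apply/asboolP; exists y => //; exact: nY.1.
  have [t ts Mt] := sP x.
  have Mt' : csub_set M (x^-1 * t).
    by have := csubV Mt; rewrite invgM invgK.
  apply: (ltn_sub_count sub ts); first by apply/asboolP; exists x.
  apply/negP => /asboolP[y Yy My]; apply: nYx.
  have := csubM My (csubV Mt'); rewrite invgM invgK -mulgA mulVKg => Myx.
  rewrite -(mulVKg y x); apply: csubM => //; apply: KY.
  by apply: CMK => //; apply/XC/csubM => //; apply/csubV/nY.1.
(* X/K now has no normal subgroups besides the trivial ones. If abelian it is central in itself,
   hence trivial; otherwise it is a component of C/K, which is excluded. *)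
have [ab|nab] := pselect (forall x y, csub_set X x -> csub_set X y -> csub_set K [~ x, y]).
  exact: (FD_section_central profG nKX KX _ _ fdX).
case: (fd.2 _ KX sX); split=> //.
- move=> L KL cL.
  have nLX : normal_in (csubI L X) X.
    split=> [x []//|x h Xx [Lh Xh]]; split; last exact: csubJ.
    by rewrite -(mulVKg h (h ^ x)) -commgEl; apply: csubM => //; exact: cL.
  have [|XL|LK] := small _ _ nLX; first by move=> x Kx; split; [exact: KL|exact: KX].
    by move=> x /XL[].
  by case: nab => x y Xx Xy; apply: LK; split; [exact: cL|exact: csubR].
move=> L KL nL; have [XL|LK] := small _ KL nL; [by left|right=> x y Lx Xy].
rewrite commgEl; apply: csubM; first exact/csubV/LK.
by apply: nKX.2 => //; exact: LK.
Qed.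

(** T lies in the kernel K of each Fitting-degenerate quotient of D, so D/K is finite and
    [FD_section_finite] makes it trivial. *)
Lemma FR_subgroup_finite D T (M : nsubgroup G) : open (M : set G) ->
  normal_in T D -> FR_subgroup T ->
  (forall x, csub_set D x -> csub_set M x -> csub_set T x) -> FR_subgroup D.
Proof.
move=> oM nT frT DMT K nK fK.
apply: (FD_section_finite oM nK fK) => x Dx Mx; apply: (residual_min nK fK).
by apply: ((FR_subgroup_subnormalP (subnormal_in_normal nT)).1 frT); exact: DMT.
Qed.

(* Both sides are the centralizer of M modulo O^[FD](M), for M open normal in G
   and contained in H. *)
Lemma residual_open H : open (H : set G) ->
  (residual H : set G) = (residual csubT : set G) `&` H.
Proof.
move=> oH.
have [M oM MH] : exists2 M : nsubgroup G, open (M : set G) & (M : set G) `<=` H.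
  by apply: openN_basis => //; apply: open_nbhs_nbhs; split=> //; exact: csub1.
have nM := nsub_normalT M.
pose T := residual M; have nT : normal_in T csubT := residual_char nM.
have nTM : normal_in T M := residual_normal M.
have [C CP] := cent_ex profG nT nM.1.
have TC : (T : set G) `<=` C.
  move=> x Tx; apply/CP; split=> // t Mt.
  by rewrite commgEl; apply: csubM; [exact: csubV|exact: nT.2].
have CM : (csubI C M : set G) `<=` T.
  apply: (FD_section_central profG nTM _ _ _ (FD_section_residual M)).
  - by move=> x Tx; split; [exact: TC|exact: nTM.1].
  - by move=> x [].
  by move=> x t [/CP[_ Cx] _] Mt; exact: Cx.
have key D : (M : set G) `<=` D -> (residual D : set G) = (C : set G) `&` D.
  move=> MD; have nMD : normal_in M D by exact: normal_sub nM MD _.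
  have nR := residual_normal D.
  (* For r in the residual of D and t in M, [r, t] lies in the intersection of that residual with M.
     This is normal in a Fitting-regular group and in M, hence contained in T. *)
  apply/seteqP; split=> [r Rr|].
    have Dr := nR.1 _ Rr; split=> //; apply/CP; split=> // t Mt.
    have nI : normal_in (csubI (residual D) M) (residual D).
      split=> [x []//|x h Rx [Rh Mh]]; split; first exact: csubJ.
      by apply: nM.2.
    have nIM : normal_in (csubI (residual D) M) M.
      split=> [x []//|x h Mx [Rh Mh]]; split; last exact: csubJ.
      by apply: nR.2 => //; exact: MD.
    have frI := FR_subgroup_normal nI (@FR_subgroup_residual D).
    apply: ((FR_subgroup_subnormalP (subnormal_in_normal nIM)).1 frI).
    split; last by rewrite commgEr; apply: csubM => //; apply: nM.2 => //; exact: csubV.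
    rewrite commgEl; apply: csubM; first exact: csubV.
    by apply: nR.2 => //; exact: MD.
  have nCD : normal_in (csubI C D) D.
    split=> [x []//|x c Dx [Cc Dc]]; split; last exact: csubJ.
    apply/CP; split=> // t Mt; have /CP[_ /(_ (t ^ x^-1)) cct] := Cc.
    rewrite -[t](conjgKV x) -conjRg; apply: nT.2 => //; apply: cct.
    exact: nM.2.
  (* Conversely, the elements of D centralizing M modulo T form a finite extension of the
     Fitting-regular T. *)
  suff : (csubI C D : set G) `<=` residual D by [].
  apply/(FR_subgroup_subnormalP (subnormal_in_normal nCD)).
  apply: (FR_subgroup_finite oM (T := T)) (@FR_subgroup_residual M) _.
    split; first by move=> x Tx; split; [exact: TC|exact/MD/nTM.1].
    by move=> x h _; exact: nT.2.
  by move=> x [Cx Dx] Mx; apply: CM.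
by rewrite key // key // setIT.
Qed.

End Residual.

(** * Translation between sections and quotient groups *)


Section Bridge.
Variable G : topGroupType.
Hypothesis profG : profinite G.
Implicit Types A B C D H K L M N Q R T : csubgroup G.

Section OneSection.
Variables (A B : csubgroup G) (X : topGroupType) (h : G -> X).
Hypothesis s : secmap A B h.

Lemma secmap_normal : normal_in A B.
Proof.
split=> [|b x Bb Ax]; first exact: sm_sub s.
have Bx := sm_sub s Ax.
apply/(sm_ker s); first exact: csubJ.
by rewrite (smJ s) // (sm_ker s Bx).2 // conj1g.
Qed.

Lemma pull_nsub (N : nsubgroup X) : normal_in (pull s N) B.
Proof.
rewrite -[X in normal_in _ X](pullB s); apply/(pull_normal s).
exact: nsub_normalT.
Qed.

(** Forwards, AM cut down to B is the pullback of an open normal D, and the order of X/D bounds the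
    needed power. Backwards, X/D is finite with all elements of p-power order. *)
Lemma pro_p_secmap p : prime p ->
  pro_p p X <-> forall x, csub_set B x -> ppow p A x.
Proof.
move=> pp; have nA := secmap_normal; split=> [pX x Bx|pB D oD].
  apply/(ppowP profG) => M oM.
  have nM := nsub_normalT M; have AT : (A : set G) `<=` csubT by [].
  pose AM := csubI (join A M) B.
  have nAM : normal_in AM B.
    split=> [y []//|b y Bb [jy By]]; split; last exact: csubJ.
    have [a [m [Aa Mm ->]]] := joinP profG nM AT jy; rewrite conjMg.
    by apply: csubM; [apply/join_l/nA.2|apply/join_r/nM.2].
  have [|D eD] := pull_push s _ nAM.1.
    by move=> a Aa; split; [exact: join_l|exact: nA.1].
  have nD : normal_in D csubT by apply/(pull_normal s); rewrite eD pullB.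
  have oD : open (nsub_of nD : set X).
    rewrite -closedC.
    have -> : ~` (nsub_of nD : set X) =
        h @` ((B : set G) `&` ~` [set x | exists2 a, csub_set A a & csub_set M (a^-1 * x)]).
      apply/seteqP; split=> [y nDy|_ [b [Bb nb] <-] Db].
        have [b Bb hb] := sm_surj s y; exists b => //; split=> // -[a Aa Mab].
        apply: nDy; rewrite -hb; suff : csub_set (pull s D) b by case.
        rewrite eD; split=> //; rewrite -(mulVKg a b).
        by apply: csubM; [exact: join_l|exact: join_r].
      have : csub_set (pull s D) b by [].
      rewrite eD => -[/(joinP profG nM AT)[a [m [Aa Mm eb]]] _].
      by apply: nb; exists a; rewrite // eb mulKg.
    apply: (sm_img s) => [|y []//]; apply: closedI; first exact: csub_closed.
    exact/open_closedC/open_translates.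
  have [k ck] := pX _ oD; exists k.
  have t := secmap_quo s (nsub_of nD).
  have : csub_set (pull s (nsub_of nD)) (x ^+ (p ^ k)%N).
    apply/(sm_ker t); first exact: csubX.
    by rewrite (smX t) //; exact: finite_group_expg ck _.
  rewrite [pull _ _]eD => -[/(joinP profG nM AT)[a [m [Aa Mm ->]]] _].
  by exists a; rewrite ?mulKg.
have t := secmap_quo s D.
apply: finite_pgroup_card => //.
  have [S SP] := open_transversal (sm_compact s) oD.
  apply: (sub_finite_set (B := \pi_(quogrp D) @` [set` S])); last first.
    exact/finite_image/finite_seq.
  move=> y _; have [x Sx Dx] := SP (repr y); exists x => //.
  by rewrite -[y]reprK; apply/quogrpP.
move=> y; have [x Bx <-] := sm_surj t y.
have := (ppow_secmap p t Bx).1 (ppow_mono (@pull_ker _ _ _ _ _ s D) (pB x Bx)).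
move=> /(_ [set 1]); apply=> //.
have -> : [set (1 : quogrp D)] = \pi_(quogrp D) @` (D : set X).
  apply/seteqP; split=> [_ ->|_ [d Dd <-]]; first by exists 1 => //; exact: csub1.
  by apply/quogrpP; rewrite mulg1; exact: csubV.
exact: quogrp_pi_open.
Qed.

Lemma perfect_secmap : perfect X <->
  forall L, (A : set G) `<=` L ->
    (forall x y, csub_set B x -> csub_set B y -> csub_set L [~ x, y]) ->
    (B : set G) `<=` L.
Proof.
split=> [pX L AL cL|perf].
  have [||L' eL'] := @pull_push _ _ _ _ _ s (csubI L B).
  - by move=> a Aa; split; [exact: AL|exact: sm_sub s _ Aa].
  - by move=> x [].
  suff : (B : set G) `<=` pull s L' by rewrite eL' => BL x /BL[].
  apply/pullT/seteqP; split=> // z _.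
  have : csub_set (gen [set z : X | exists x y, z = [~ x, y]]) z by rewrite pX.
  apply: gen_min => _ [x [y ->]].
  have [a Ba <-] := sm_surj s x; have [b Bb <-] := sm_surj s y.
  rewrite -(smR s) //; suff : csub_set (pull s L') [~ a, b] by case.
  by rewrite eL'; split; [exact: cL|exact: csubR].
apply/(pullT s); apply: perf; first exact: pull_ker.
move=> x y Bx By; split; first exact: csubR.
by rewrite /= (smR s) //; apply: gen_sub; exists (h x), (h y).
Qed.

Lemma pull_center x : csub_set (pull s (center X)) x <->
  csub_set B x /\ forall y, csub_set B y -> csub_set A [~ x, y].
Proof.
split=> [[Bx Zx]|[Bx Zx]]; split=> //.
  by move=> y By; apply/(sm_comm s).
by move=> y; have [b Bb <-] := sm_surj s y; apply/(sm_comm s) => //; exact: Zx.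
Qed.

(** Simplicity of X modulo its center becomes a dichotomy for all normal subgroups: contain
    everything or be central. A normal M is compared with MZ, Z being the pullback of the center. *)
Lemma quasisimple_secmap : quasisimple X <-> qs_section A B.
Proof.
pose Z := pull s (center X); have t := secmap_quo s (center X).
have AZ : (A : set G) `<=` Z := @pull_ker _ _ _ _ _ s (center X).
have trivP : trivial_group (quogrp (center X)) <-> (B : set G) `<=` Z.
  split=> [tr x Bx|BZ y]; first exact/(sm_ker t Bx).
  by have [x Bx <-] := sm_surj t y; apply/(sm_ker t Bx)/BZ.
split=> [[/perfect_secmap perf [ntriv simp]]|[nab perf dich]].
  split=> // [ab|M AM nM].
    apply: ntriv; apply/trivP => x Bx; apply/pull_center; split=> // y By.
    exact: ab.
  have nZ : normal_in Z B := pull_nsub (center X).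
  have nJ := join_normal_top profG nM nZ.
  have [N eN] := pull_push t (join_r M Z) nJ.1.
  have nN : normal_in N csubT by apply/(pull_normal t); rewrite eN pullB.
  have [N1|NT] := simp (nsub_of nN).
    right=> x y Mx By.
    have NZ : (pull t N : set G) `<=` Z by exact/(pull1 t).
    rewrite eN in NZ; have /pull_center[_] := NZ _ (join_l M Z _ Mx); exact.
  (* Here B = MZ with Z central modulo A, so B/M is abelian and, by perfectness, trivial. *)
  left; have BJ : (B : set G) `<=` join M Z by rewrite -eN; exact/(pullT t).
  apply: perf => // x y Bx By.
  have [Y [g u]] := secmap_section profG nM.
  apply/(sm_comm u Bx By).
  have [m [z [Mm Zz ex]]] := joinP profG nZ nM.1 (BJ _ Bx).
  have /pull_center[Bz cz] := Zz.
  rewrite ex (smM u) //; last exact: nM.1.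
  rewrite (sm_ker u (nM.1 _ Mm)).2 // mul1g.
  by apply/(sm_comm u) => //; apply/AM/cz.
split; first exact/perfect_secmap.
split=> [/trivP BZ|N].
  by apply: nab => x y Bx By; have /pull_center[_] := BZ _ Bx; exact.
have AN : (A : set G) `<=` pull t N.
  by apply: subset_trans AZ _; exact: pull_ker.
have nN : normal_in (pull t N) B.
  by rewrite -[X in normal_in _ X](pullB t); apply/(pull_normal t)/nsub_normalT.
have [BN|cN] := dich _ AN nN; first by right; apply/(pullT t).
left; apply/(pull1 t) => x Nx; apply/pull_center; split; first exact: nN.1.
by move=> y By; exact: cN.
Qed.

Lemma subnormal_pull (L : csubgroup X) : subnormal L -> subnormal_in B (pull s L).
Proof.
elim=> [H HT|H L' _ IH nH].
  have -> : pull s H = B; last exact: subnormal_in_refl.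
  by apply: csub_eqP => [x []//|]; apply/pullT.
by apply: subnormal_in_step IH _; exact/pull_normal.
Qed.

Lemma subnormal_push M : subnormal_in B M -> (A : set G) `<=` M ->
  exists2 L : csubgroup X, pull s L = M & subnormal L.
Proof.
elim=> [_|H M' sM' IH nH AH]; first by exists csubT; [exact: pullB|exact: subnormal_top].
have [L' eL' sL'] := IH (subset_trans AH nH.1).
have HB : (H : set G) `<=` B := subset_trans nH.1 (subnormal_in_sub sM').
have [L eL] := pull_push s AH HB; exists L => //.
by apply: subnormal_step sL' _; apply/(pull_normal s); rewrite eL eL'.
Qed.

End OneSection.

(** A generated subgroup is trivial exactly when all its generating subgroups are, so only normal
    pro-p subgroups and components need translating. *)
Lemma fitting_degenerate_secmap A B (X : topGroupType) (h : G -> X)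
    (s : secmap A B h) : fitting_degenerate X <-> FD_section A B.
Proof.
have nA := secmap_normal s; split=> [fX|[fdp fdq]].
  have sub1 (L : csubgroup X) : (L : set X) `<=` gen_fitting X -> (pull s L : set G) `<=` A.
    rewrite fX => L1; apply/(pull1 s)/seteqP; split=> // _ ->; exact: csub1.
  split=> [p N pp AN nN pN|Q AQ sQ qQ].
    have [L eL] := pull_push s AN nN.1.
    have nL : normal_in L csubT by apply/(pull_normal s); rewrite eL pullB.
    rewrite -eL; apply: sub1 => x Lx; apply: gen_sub; left; apply: gen_sub.
    exists p => //; apply: gen_sub; exists (nsub_of nL) => //=.
    by apply/(pro_p_secmap (secmap_sub s L) pp); rewrite eL.
  have [L eL sL] := subnormal_push s sQ AQ.
  apply: (qs_nsub qQ); rewrite -eL; apply: sub1 => x Lx.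
  apply: gen_sub; right; apply: gen_sub; exists L => //; split=> //.
  by apply/(quasisimple_secmap (secmap_sub s L)); rewrite eL.
apply/seteqP; split=> [|_ ->]; last exact: csub1.
apply: (gen_min (H := csub_triv)) => x [|].
  apply: (gen_min (H := csub_triv)) => {}x [p pp].
  apply: (gen_min (H := csub_triv)) => {}x [N pN Nx] /=.
  suff : (pull s N : set G) `<=` A by move=> /(pull1 s) N1; move: Nx; rewrite N1.
  apply: (fdp p) => //; first exact: pull_ker.
    exact: pull_nsub.
  exact/(pro_p_secmap (secmap_sub s N)).
apply: (gen_min (H := csub_triv)) => {}x [Q [sQ qQ] _] /=.
case: (fdq (pull s Q)); first exact: pull_ker.
  exact: subnormal_pull.
exact/(quasisimple_secmap (secmap_sub s Q)).
Qed.

Lemma fitting_regular_secmap B (X : topGroupType) (h : G -> X)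
    (s : secmap csub_triv B h) : fitting_regular X <-> FR_subgroup B.
Proof.
have trivP (K : nsubgroup X) : trivial_group (quogrp K) <-> (B : set G) `<=` pull s K.
  have t := secmap_quo s K.
  split=> [tr x Bx|BK y]; first exact/(sm_ker t Bx).
  by have [x Bx <-] := sm_surj t y; apply/(sm_ker t Bx)/BK.
split=> [fr K nK fK|fr K ntr fK].
  have K1 : (csub_triv : set G) `<=` K by move=> _ ->; exact: csub1.
  have [L eL] := pull_push s K1 nK.1.
  have nL : normal_in L csubT by apply/(pull_normal s); rewrite eL pullB.
  apply: contrapT => nBK; apply: (fr (nsub_of nL)).
    by move=> /trivP; rewrite [pull _ _]eL.
  by apply/(fitting_degenerate_secmap (secmap_quo s (nsub_of nL))); rewrite [pull _ _]eL.
apply: ntr; apply/trivP; apply: fr; first exact: pull_nsub.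
exact/(fitting_degenerate_secmap (secmap_quo s K)).
Qed.

(** A normal subgroup is Fitting-regular exactly when it lies in the residual, which is itself
    normal; so the residual is the largest of the subgroups generating the radical. *)
Lemma FR_radical_secmap B (X : topGroupType) (h : G -> X)
    (s : secmap csub_triv B h) : pull s (FR_radical X) = residual B.
Proof.
have nR := residual_normal B.
have frP (N : nsubgroup X) :
    fitting_regular (subgrp N) <-> (pull s N : set G) `<=` residual B.
  rewrite (fitting_regular_secmap (secmap_sub s N)).
  exact/(FR_subgroup_subnormalP profG)/subnormal_in_normal/pull_nsub.
have R1 : (csub_triv : set G) `<=` residual B by move=> _ ->; exact: csub1.
have [L eL] := pull_push s R1 nR.1.
have nL : normal_in L csubT by apply/(pull_normal s); rewrite eL pullB.
rewrite -eL; congr pull; apply: csub_eqP.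
  by apply: gen_min => x [N /frP]; rewrite -eL => /(pull_subset s) NL /NL.
by move=> x Lx; apply: gen_sub; exists (nsub_of nL) => //; apply/frP; rewrite [pull _ _]eL.
Qed.

End Bridge.

Theorem theoremA (G : topGroupType) (profG : profinite G) :
  FD_residual G = FR_radical G :> set G /\
  (let R := FD_residual G in
   [/\ characteristic R,
       (forall H : csubgroup G, subnormal H ->
          (fitting_regular (subgrp H) <-> (H : set G) `<=` R)),
       fitting_degenerate (quogrp R) &
       (forall K : nsubgroup G, fitting_degenerate (quogrp K) ->
          (R : set G) `<=` K)]) /\
  (forall H : csubgroup G, open (H : set G) ->
     val @` (FR_radical (subgrp H) : set (subgrp H)) =
     (FR_radical G : set G) `&` H).
Proof.
have s := secmap_id profG.1.
have pullE H : pull s H = H by apply: csub_eqP => [x []|x Hx] //; split.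
have fdP (K : nsubgroup G) : fitting_degenerate (quogrp K) <-> FD_section K csubT.
  by rewrite (fitting_degenerate_secmap profG (secmap_quo s K)) pullE.
have resE : FD_residual G = residual csubT :> csubgroup G.
  apply: csub_eqP => x Rx.
    move=> K [nK fK]; apply: (Rx K); exists (nsub_of nK) => //=.
    exact/fdP.
  by move=> _ [K /fdP fK <-]; apply: Rx; split=> //; exact: nsub_normalT.
have radE : FR_radical G = residual csubT.
  by rewrite -[LHS]pullE; exact: FR_radical_secmap.
split; first by rewrite resE radE.
split.
  split.
  - move=> f g fK gK fM cf cg; rewrite resE.
    have gM : {morph g : x y / x * y}.
      by move=> x y; apply: (can_inj fK); rewrite fM !gK.
    have preT (k : G -> G) (kM : {morph k : x y / x * y}) (ck : continuous k) :
        csub_pre kM ck csubT = csubT by exact: csub_eqP.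
    (* Both f and its inverse g map the residual into itself. *)
    apply/seteqP; split=> [_ [x Rx <-]|x Rx].
      exact: (residual_pre gM cg gK fK (preT _ fM cf)).
    exists (g x); last exact: gK.
    exact: (residual_pre fM cf fK gK (preT _ gM cg)).
  - move=> H sH; rewrite resE.
    rewrite (fitting_regular_secmap profG (secmap_sub s H)) pullE.
    apply: (FR_subgroup_subnormalP profG); rewrite -[H]pullE.
    exact: subnormal_pull.
  - by apply/fdP; rewrite resE; exact: FD_section_residual.
  - by move=> K fK x; apply; exists K.
move=> H oH; rewrite radE -(residual_open profG oH).
(* Through this presentation of [subgrp H] its radical pulls back to the residual of H computed
   inside G. *)
have := secmap_sub s H; rewrite pullE => t.
rewrite -(FR_radical_secmap profG t).
apply/seteqP; split=> [_ [y Ry <-]|x [Hx Rx]].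
  split; first exact: subgrp_valP.
  by rewrite /= valKd.
by eexists; [exact: Rx|rewrite insubdK //; exact/mem_set].
Qed.
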